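(* Every Lie groupoid is coverable.
   Context: A Lie groupoid is a groupoid $G$ with $G_0$, $G_1$ smooth (Hausdorff) manifolds, smooth structure maps, and domain map $d:G_1\to G_0$ a submersion (so $d$ is open). Composable pairs $(x,y)$ have $r(x)=d(y)$. Since $G_1$ is locally compact and sober, $G$ is regarded as an open localic groupoid through the topologies: $\mathcal O(G_k)=\Omega(G_k)$, the lattice of open sets. Its quantale $Q=\mathcal O(G)$ is $\Omega(G_1)$ with pointwise product $AB=\{xy:x\in A,y\in B,r(x)=d(y)\}$ and involution $A^*=\{x^{-1}:x\in A\}$; the top $1$ is $G_1$. $R(Q)=\{a\in Q:a1\le a\}$, a subframe (isomorphic to $\Omega(G_0)$ via $d^{-1}$). $Q$ is an $R(Q)$-$R(Q)$-bimodule via $z\cdot a=a\wedge z$, $a\cdot z=a\wedge z^*$, and $Q\otimes_{R(Q)}Q$ is the tensor product of sup-lattices. Regard frames also as locales; for a locale map $f$, $f^*$ is its inverse image, while for $a\in Q$, $a^*$ is the involute. $d,r:Q\to R(Q)$, $i:Q\to Q$ are the locale maps with $d^*(z)=z$, $r^*(z)=z^*$, $i^*(a)=a^*$. For $U\in R(Q)$, $\widetilde U$ is the locale with frame $\{z\in R(Q):z\le U\}$, and $k_U:\widetilde U\to R(Q)$ has $k_U^*(z)=z\wedge U$. A local bisection is a pair $\sigma=(U,s)=(U_\sigma,s_\sigma)$, $U\in R(Q)$, $s:\widetilde U\to Q$ a locale map with $d\circ s=k_U$ and $r\circ s$ an open regular monomorphism (here these correspond to continuous local sections $s$ of $d$ on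 open subsets of $G_0$ such that $r\circ s$ is an open embedding); then $r\circ s=k_V\circ\alpha$ with $\alpha:\widetilde U\to\widetilde V$ an isomorphism, and $\sigma^{-1}=(V,i\circ s\circ\alpha^{-1})$. The product $\sigma\tau$ has $U_{\sigma\tau}=s_\sigma^*(U_\tau^* )$ and $s_{\sigma\tau}^*(a)=\bigvee_{xy\le a}s_\sigma^*(x\wedge s_\tau^*(y)^* )$. The set $\Gamma(Q)$ of local bisections is a complete infinitely distributive inverse semigroup, with natural order given by restriction. Put $\sigma\cdot a=\bigvee_{x^*y\le a}s_\sigma^*(x)\wedge y$. $\widehat Q=\mathcal L^\vee(\Gamma(Q))$: the set of downwards closed subsets of $\Gamma(Q)$ closed under joins of compatible families ($\sigma,\tau$ compatible: $\sigma\tau^{-1}$, $\sigma^{-1}\tau$ idempotent), ordered by inclusion, with product $AB$ the least such subset containing all $\sigma\tau$ ($\sigma\in A,\tau\in B$) and involution $A^*=\{\sigma^{-1}:\sigma\in A\}$. Write $\widehat\sigma=\{\tau:\tau\le\sigma\}$. The frame homomorphism $j:Q\to\widehat Q$ is $j(a)=\{\sigma:s_\sigma^*(a)=U_\sigma\}$. $\widehat Q$ is an $R(Q)$-$R(Q)$-bimodule via $z\cdot A=j(z)\wedge A$, $A\cdot z=A\wedge j(z^* )$. $G$ is coverable if $Q=\mathcal O(G)$ is embeddable, i.e. $\widehat\sigma\,j(a)=j(\sigma\cdot a)$ for all $\sigma\in\Gamma(Q)$, $a\in Q$ (weak embeddability), and $j\otimes\mathrm{id}:Q\otimes_{R(Q)}Q\to\widehat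 Q\otimes_{R(Q)}Q$ is a monomorphism. *)

(* Defs.v *)
From HB Require Import structures.
From mathcomp Require Import all_boot all_order all_algebra.
From mathcomp Require Import all_classical reals topology normedtype derive.

Set Implicit Arguments.
Unset Strict Implicit.
Unset Printing Implicit Defensive.

Import GRing.Theory.
Import numFieldNormedType.Exports.

Local Open Scope classical_set_scope.

Declare Scope locale_scope.
Delimit Scope locale_scope with loc.
Local Open Scope locale_scope.
#[local] Obligation Tactic := idtac.

Reserved Notation "x '⊑' y" (at level 70, no associativity).
Reserved Notation "x '⊓' y" (at level 40, left associativity).
Reserved Notation "'⋁' S" (at level 35, right associativity).
Reserved Notation "x '⋅' y" (at level 40, left associativity).
Reserved Notation "f '^★'" (at level 1, left associativity, format "f '^★'").

Record suplat := SupLat {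
  scar :> Type;
  sle : scar -> scar -> Prop;
  ssup : set scar -> scar;
  sle_refl : forall x, sle x x;
  sle_trans : forall y x z, sle x y -> sle y z -> sle x z;
  sle_anti : forall x y, sle x y -> sle y x -> x = y;
  ssup_ub : forall (S : set scar) x, S x -> sle x (ssup S);
  ssup_le : forall (S : set scar) y,
    (forall x, S x -> sle x y) -> sle (ssup S) y }.

Arguments sle {s} x y.
Arguments ssup {s} S.

Notation "x ⊑ y" := (sle x y) : locale_scope.
Notation "⋁ S" := (ssup S) : locale_scope.

Definition smeet (L : suplat) (x y : L) : L := ⋁ [set z | z ⊑ x /\ z ⊑ y].
Definition stop (L : suplat) : L := ⋁ [set: L].
Arguments smeet {L} x y : simpl never.
Arguments stop {L} : simpl never.
Notation "x ⊓ y" := (smeet x y) : locale_scope.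

Lemma smeetl (L : suplat) (x y : L) : x ⊓ y ⊑ x.
Proof. by apply: ssup_le => z []. Qed.

Lemma smeetr (L : suplat) (x y : L) : x ⊓ y ⊑ y.
Proof. by apply: ssup_le => z []. Qed.

Lemma smeet_glb (L : suplat) (x y z : L) : z ⊑ x -> z ⊑ y -> z ⊑ x ⊓ y.
Proof. by move=> zx zy; apply: ssup_ub. Qed.

Lemma smeet_mono (L : suplat) (x x' y y' : L) :
  x ⊑ x' -> y ⊑ y' -> x ⊓ y ⊑ x' ⊓ y'.
Proof.
move=> xx yy; apply: smeet_glb.
- exact: sle_trans (smeetl x y) xx.
- exact: sle_trans (smeetr x y) yy.
Qed.

Lemma smeetC (L : suplat) (x y : L) : x ⊓ y = y ⊓ x.
Proof.
by apply: sle_anti; apply: smeet_glb; first [exact: smeetl|exact: smeetr].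
Qed.

Lemma smeet_idl (L : suplat) (x y : L) : x ⊑ y -> x ⊓ y = x.
Proof.
move=> xy; apply: sle_anti; first exact: smeetl.
by apply: smeet_glb => //; exact: sle_refl.
Qed.

Lemma smeetA (L : suplat) (x y z : L) : x ⊓ (y ⊓ z) = x ⊓ y ⊓ z.
Proof.
apply: sle_anti.
- apply: smeet_glb; [apply: smeet_glb|].
  + exact: smeetl.
  + exact: sle_trans (smeetr _ _) (smeetl _ _).
  + exact: sle_trans (smeetr _ _) (smeetr _ _).
- apply: smeet_glb; [|apply: smeet_glb].
  + exact: sle_trans (smeetl _ _) (smeetl _ _).
  + exact: sle_trans (smeetl _ _) (smeetr _ _).
  + exact: smeetr.
Qed.

Lemma sle_top (L : suplat) (x : L) : x ⊑ stop.
Proof. exact: ssup_ub. Qed.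

Lemma smeetxx (L : suplat) (x : L) : x ⊓ x = x.
Proof. by apply: smeet_idl; exact: sle_refl. Qed.

Record frame := Frame {
  flat :> suplat;
  frame_distr : forall (x : flat) (S : set flat),
    x ⊓ ⋁ S ⊑ ⋁ [set x ⊓ y | y in S] }.

Record suphom (L M : suplat) := SupHom {
  supfun :> L -> M;
  supfun_sup : forall S : set L, supfun (⋁ S) = ⋁ (supfun @` S) }.

(** A locale map is given by its inverse image, a frame homomorphism in the
    opposite direction; two locale maps are equal when their inverse images
    agree pointwise. *)
Record locmap (X Y : frame) := LocMap {
  invim : Y -> X;
  invim_sup : forall S : set Y, invim (⋁ S) = ⋁ (invim @` S);
  invim_meet : forall x y : Y, invim (x ⊓ y) = invim x ⊓ invim y;
  invim_top : invim stop = stop }.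

Notation "f '^★'" := (invim f) : locale_scope.

Definition lm_eq (X Y : frame) (f g : locmap X Y) : Prop :=
  forall y, f^★ y = g^★ y.

Lemma invim_mono (X Y : frame) (f : locmap X Y) (x y : Y) :
  x ⊑ y -> f^★ x ⊑ f^★ y.
Proof. by move=> /smeet_idl <-; rewrite invim_meet; exact: smeetr. Qed.

Program Definition lm_id (X : frame) : locmap X X :=
  @LocMap X X (fun x => x) _ _ _.
Next Obligation. by move=> X S; rewrite image_id. Qed.
Next Obligation. by []. Qed.
Next Obligation. by []. Qed.

Program Definition lm_comp (X Y Z : frame) (g : locmap Y Z) (f : locmap X Y) :
  locmap X Z := @LocMap X Z (fun z => f^★ (g^★ z)) _ _ _.
Next Obligation. by move=> X Y Z g f S /=; rewrite !invim_sup image_comp. Qed.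
Next Obligation. by move=> X Y Z g f x y /=; rewrite !invim_meet. Qed.
Next Obligation. by move=> X Y Z g f /=; rewrite !invim_top. Qed.

Notation "g '∘l' f" := (lm_comp g f) (at level 50, left associativity)
  : locale_scope.

Definition lm_open (X Y : frame) (f : locmap X Y) : Prop :=
  exists dir : X -> Y,
    (forall x y, dir x ⊑ y <-> x ⊑ f^★ y) /\
    (forall x y, dir (x ⊓ f^★ y) = dir x ⊓ y).

(** A regular monomorphism is an equalizer of some pair of locale maps. *)
Definition lm_regular_mono (X Y : frame) (f : locmap X Y) : Prop :=
  exists (Z : frame) (g h : locmap Y Z),
    lm_eq (g ∘l f) (h ∘l f) /\
    forall (W : frame) (k : locmap W Y), lm_eq (g ∘l k) (h ∘l k) ->
      exists l : locmap W X, lm_eq (f ∘l l) k /\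
        forall l' : locmap W X, lm_eq (f ∘l l') k -> lm_eq l' l.

Lemma sig_inj (T : Type) (P : T -> Prop) (x y : {z | P z}) :
  sval x = sval y -> x = y.
Proof.
case: x y => [x px] [y py] /= xy; subst y.
by congr exist; exact: Prop_irrelevance.
Qed.

(** Closed under joins and binary meets; the top need not be that of [L], so
    that this covers both subframes and principal downsegments. *)
Section subframe.
Variables (L : frame) (P : L -> Prop).
Hypothesis Psup : forall S : set L, (forall x, S x -> P x) -> P (⋁ S).
Hypothesis Pmeet : forall x y, P x -> P y -> P (x ⊓ y).

Let C := {x : L | P x}.
Let le (x y : C) := sval x ⊑ sval y.
Let sup_closed (S : set C) : P (⋁ (sval @` S)).
Proof. by apply: Psup => _ [x _ <-]; exact: (svalP x). Qed.

Program Definition sub_suplat : suplat := @SupLat C le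
  (fun S => exist _ (⋁ (sval @` S)) (sup_closed S)) _ _ _ _ _.
Next Obligation. by move=> x; exact: sle_refl. Qed.
Next Obligation. by move=> y x z; exact: sle_trans. Qed.
Next Obligation. by move=> x y xy yx; apply: sig_inj; exact: sle_anti. Qed.
Next Obligation. by move=> S x Sx; apply: ssup_ub; exists x. Qed.
Next Obligation. by move=> S y Sy; apply: ssup_le => _ [x Sx <-]; exact: Sy. Qed.

Lemma sub_meetE (x y : sub_suplat) : sval (x ⊓ y) = sval x ⊓ sval y.
Proof.
apply: sle_anti.
- by apply: smeet_glb; [exact: (smeetl x y)|exact: (smeetr x y)].
- have := @smeet_glb sub_suplat x y
    (exist _ (sval x ⊓ sval y) (Pmeet (svalP x) (svalP y))).
  by apply; [exact: smeetl|exact: smeetr].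
Qed.

Program Definition subframe : frame := @Frame sub_suplat _.
Next Obligation.
move=> x S; rewrite /sle/= /le sub_meetE /=.
apply: sle_trans (frame_distr _ _) _; apply: ssup_le => _ [_ [y Sy <-] <-].
apply: ssup_ub; exists (x ⊓ y); last by rewrite sub_meetE.
by exists y.
Qed.

End subframe.

(** The frame [Ũ] of the open sublocale [U], and its inclusion [k_U]. *)
Section segment.
Variables (L : frame) (U : L).

Let seg_sup (S : set L) : (forall x, S x -> x ⊑ U) -> ⋁ S ⊑ U.
Proof. exact: ssup_le. Qed.
Let seg_meet (x y : L) : x ⊑ U -> y ⊑ U -> x ⊓ y ⊑ U.
Proof. by move=> xU _; exact: sle_trans (smeetl _ _) xU. Qed.

Definition seg : frame := subframe seg_sup seg_meet.

Lemma seg_topE : sval (stop : seg) = U.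
Proof.
apply: sle_anti; first exact: (svalP (stop : seg)).
exact: (@sle_top seg (exist (fun x => x ⊑ U) U (sle_refl U)) : sle (s := L) _ _).
Qed.

Lemma seg_meetE (x y : seg) : sval (x ⊓ y) = sval x ⊓ sval y.
Proof. by rewrite /seg sub_meetE. Qed.

Lemma seg_supE (S : set seg) : sval (⋁ S) = ⋁ (sval @` S).
Proof. by []. Qed.

Lemma distr_r (S : set L) : ⋁ S ⊓ U = ⋁ [set x ⊓ U | x in S].
Proof.
apply: sle_anti.
- rewrite smeetC; apply: sle_trans (frame_distr _ _) _.
  apply: ssup_le => _ [y Sy <-]; apply: ssup_ub; exists y => //.
  exact: smeetC.
- apply: ssup_le => _ [y Sy <-]; apply: smeet_mono; last exact: sle_refl.
  exact: ssup_ub.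
Qed.

Program Definition k_ : locmap seg L :=
  @LocMap seg L (fun z => exist _ (z ⊓ U) (smeetr z U)) _ _ _.
Next Obligation. by move=> S; apply: sig_inj; rewrite /= image_comp distr_r. Qed.
Next Obligation.
move=> x y; apply: sig_inj; rewrite seg_meetE /=.
by rewrite -(smeetA x U) (smeetC U) -(smeetA y U U) smeetxx smeetA.
Qed.
Next Obligation.
by apply: sig_inj; rewrite seg_topE /= smeetC smeet_idl //; exact: sle_top.
Qed.

End segment.

Definition lm_iso (X Y : frame) (f : locmap X Y) (g : locmap Y X) : Prop :=
  lm_eq (g ∘l f) (lm_id X) /\ lm_eq (f ∘l g) (lm_id Y).

(** The kernel pair of an inverse image; it exhibits a locale map with
    surjective inverse image as an equalizer. *)
Section kernel_pair.
Variables (X Y : frame) (f : locmap X Y).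

Let C := {p : Y * Y | f^★ p.1 = f^★ p.2}.
Let le (p q : C) := (sval p).1 ⊑ (sval q).1 /\ (sval p).2 ⊑ (sval q).2.
Let p1 (p : C) := (sval p).1.
Let p2 (p : C) := (sval p).2.
Let supP (S : set C) : f^★ (⋁ (p1 @` S)) = f^★ (⋁ (p2 @` S)).
Proof.
rewrite !invim_sup !image_comp; congr ssup; apply: eq_imagel => p _ /=.
exact: (svalP p).
Qed.
Let sup (S : set C) : C := exist (fun p => f^★ p.1 = f^★ p.2)
  (⋁ (p1 @` S), ⋁ (p2 @` S)) (supP S).

Program Definition kp_suplat : suplat := @SupLat C le sup _ _ _ _ _.
Next Obligation. by move=> p; split; exact: sle_refl. Qed.
Next Obligation.
by move=> y x z [a b] [c d]; split; [exact: sle_trans a c|exact: sle_trans b d].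
Qed.
Next Obligation.
move=> x y [a b] [c d]; apply: sig_inj.
by apply: injective_projections; exact: sle_anti.
Qed.
Next Obligation. by move=> S x Sx; split; apply: ssup_ub; exists x. Qed.
Next Obligation.
by move=> S y Sy; split; apply: ssup_le => _ [x Sx <-]; case: (Sy x Sx).
Qed.

Lemma kp_meetE (x y : kp_suplat) :
  sval (x ⊓ y) = (p1 x ⊓ p1 y, p2 x ⊓ p2 y).
Proof.
have mP : f^★ (p1 x ⊓ p1 y) = f^★ (p2 x ⊓ p2 y).
  by rewrite !invim_meet (svalP x : f^★ (p1 x) = _) (svalP y : f^★ (p1 y) = _).
pose m : kp_suplat := exist (fun p => f^★ p.1 = f^★ p.2) (_, _) mP.
have -> // : x ⊓ y = m.
apply: (@sle_anti kp_suplat).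
- have [a b] := smeetl x y; have [c d] := smeetr x y.
  by split; exact: smeet_glb.
- by apply: smeet_glb; split; first [exact: smeetl|exact: smeetr].
Qed.

Program Definition kp_frame : frame := @Frame kp_suplat _.
Next Obligation.
move=> x S; split; rewrite kp_meetE /=; apply: sle_trans (frame_distr _ _) _;
  apply: ssup_le => _ [_ [y Sy <-] <-]; apply: ssup_ub; exists (x ⊓ y);
  by [exists y|rewrite /p1 /p2 kp_meetE].
Qed.

Lemma kp_topE : sval (stop : kp_frame) = (stop, stop).
Proof.
pose m : kp_suplat := exist (fun p => f^★ p.1 = f^★ p.2) (stop, stop) erefl.
have -> // : (stop : kp_frame) = m.
by apply: (@sle_anti kp_suplat); [split; exact: sle_top|exact: sle_top].
Qed.

Program Definition kp1 : locmap Y kp_frame := @LocMap Y kp_frame p1 _ _ _.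
Next Obligation. by []. Qed.
Next Obligation. by move=> x y; rewrite /p1 kp_meetE. Qed.
Next Obligation. by rewrite /p1 kp_topE. Qed.

Program Definition kp2 : locmap Y kp_frame := @LocMap Y kp_frame p2 _ _ _.
Next Obligation. by []. Qed.
Next Obligation. by move=> x y; rewrite /p2 kp_meetE. Qed.
Next Obligation. by rewrite /p2 kp_topE. Qed.

Lemma surj_regular_mono :
  (forall x, exists y, f^★ y = x) -> lm_regular_mono f.
Proof.
move=> surj; exists kp_frame, kp1, kp2; split; first by move=> p; exact: (svalP p).
move=> W k kE; have [s sK] := choice surj.
have kk y y' : f^★ y = f^★ y' -> k^★ y = k^★ y'.
  by move=> e; exact: (kE (exist (fun p => f^★ p.1 = f^★ p.2) (y, y') e)).
have lE x : k^★ (s (f^★ x)) = k^★ x by apply: kk; rewrite sK.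
pose l : X -> W := fun x => k^★ (s x).
have lsup (S : set X) : l (⋁ S) = ⋁ (l @` S).
  rewrite /l -[in RHS](image_comp s) -(invim_sup k); apply: kk.
  rewrite sK invim_sup image_comp; congr ssup.
  by apply/seteqP; split => [x Sx|_ [x Sx <-]]; [exists x => //=|rewrite /= sK].
have lmeet x y : l (x ⊓ y) = l x ⊓ l y.
  by rewrite /l -(invim_meet k); apply: kk; rewrite sK invim_meet !sK.
have ltop : l stop = stop.
  by rewrite /l -(invim_top k); apply: kk; rewrite sK invim_top.
exists (LocMap lsup lmeet ltop); split=> [y|l' l'E x]; first exact: lE.
by rewrite /= /l -[in LHS](sK x); exact: l'E.
Qed.

End kernel_pair.

(** The locale of the image of [f]: conversely an equalizer has surjective
    inverse image. *)
Section image_frame.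
Variables (X Y : frame) (f : locmap X Y).

Let P (x : X) := exists y, f^★ y = x.
Let Psup (S : set X) : (forall x, S x -> P x) -> P (⋁ S).
Proof.
move=> SP; exists (⋁ [set y | S (f^★ y)]); rewrite invim_sup; congr ssup.
apply/seteqP; split => [_ [y Sy <-]//|x Sx]; have [y yE] := SP _ Sx.
by exists y => //=; rewrite yE.
Qed.
Let Pmeet x y : P x -> P y -> P (x ⊓ y).
Proof. by move=> [a <-] [b <-]; exists (a ⊓ b); rewrite invim_meet. Qed.

Definition im_frame : frame := subframe Psup Pmeet.

Lemma im_topE : sval (stop : im_frame) = stop.
Proof.
apply: sle_anti; first exact: sle_top.
exact: (@sle_top im_frame (exist P stop (ex_intro _ stop (invim_top f)))).
Qed.

Program Definition im_corestr : locmap im_frame Y :=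
  @LocMap im_frame Y (fun y => exist P (f^★ y) (ex_intro _ y erefl)) _ _ _.
Next Obligation. by move=> S; apply: sig_inj; rewrite /= invim_sup image_comp. Qed.
Next Obligation. by move=> x y; apply: sig_inj; rewrite [RHS](sub_meetE Pmeet) /= invim_meet. Qed.
Next Obligation. by apply: sig_inj; rewrite im_topE /= invim_top. Qed.

Program Definition im_restr : locmap X im_frame :=
  @LocMap X im_frame sval _ _ _.
Next Obligation. by []. Qed.
Next Obligation. by move=> x y; rewrite sub_meetE. Qed.
Next Obligation. exact: im_topE. Qed.

Lemma regular_mono_surj :
  lm_regular_mono f -> forall x, exists y, f^★ y = x.
Proof.
move=> [Z [g [h [fE univ]]]] x.
have [|l [lE _]] := univ im_frame im_corestr.
  by move=> z; apply: sig_inj; exact: fE.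
have [l0 [_ l0E]] := univ X f fE.
have lx : sval (l^★ x) = x.
  have e1 : lm_eq (lm_id X) l0 by apply: l0E.
  have e2 : lm_eq (l ∘l im_restr) l0.
    by apply: l0E => y; have /(congr1 sval) := lE y.
  by rewrite -[LHS]/((l ∘l im_restr)^★ x) e2 -e1.
by have [y yE] := svalP (l^★ x); exists y; rewrite yE.
Qed.

End image_frame.

Lemma lm_regular_monoP (X Y : frame) (f : locmap X Y) :
  lm_regular_mono f <-> forall x, exists y, f^★ y = x.
Proof. by split; [exact: regular_mono_surj|exact: surj_regular_mono]. Qed.

Record qframe := QFrame {
  qfr :> frame;
  qmul : qfr -> qfr -> qfr;
  qinv : qfr -> qfr;
  qmulA : forall a b c, qmul a (qmul b c) = qmul (qmul a b) c;
  qmul_supl : forall (S : set qfr) b, qmul (⋁ S) b = ⋁ [set qmul a b | a in S];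
  qmul_supr : forall a (S : set qfr), qmul a (⋁ S) = ⋁ [set qmul a b | b in S];
  qinvK : forall a, qinv (qinv a) = a;
  qinvM : forall a b, qinv (qmul a b) = qmul (qinv b) (qinv a);
  qinv_sup : forall S : set qfr, qinv (⋁ S) = ⋁ (qinv @` S) }.

Notation "a ⋅ b" := (qmul a b) : locale_scope.
Notation "a '^i'" := (qinv a) (at level 1, left associativity, format "a '^i'")
  : locale_scope.

Lemma ssup2 (L : suplat) (a b : L) : a ⊑ b -> ⋁ [set x | x = a \/ x = b] = b.
Proof.
move=> ab; apply: sle_anti; last by apply: ssup_ub; right.
by apply: ssup_le => x [->|->] //; exact: sle_refl.
Qed.

Lemma qmul_monol (Q : qframe) (a b c : Q) : a ⊑ b -> a ⋅ c ⊑ b ⋅ c.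
Proof.
move=> ab; rewrite -(ssup2 ab) qmul_supl; apply: ssup_ub.
by exists a => //; left.
Qed.

Lemma qinv_mono (Q : qframe) (a b : Q) : a ⊑ b -> a^i ⊑ b^i.
Proof.
move=> ab; rewrite -(ssup2 ab) qinv_sup; apply: ssup_ub.
by exists a => //; left.
Qed.

Lemma qinv_meet (Q : qframe) (a b : Q) : (a ⊓ b)^i = a^i ⊓ b^i.
Proof.
apply: sle_anti.
- by apply: smeet_glb; apply: qinv_mono; [exact: smeetl|exact: smeetr].
- rewrite -[X in X ⊑ _]qinvK; apply: qinv_mono; apply: smeet_glb.
  + by rewrite -[X in _ ⊑ X]qinvK; apply: qinv_mono; exact: smeetl.
  + by rewrite -[X in _ ⊑ X]qinvK; apply: qinv_mono; exact: smeetr.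
Qed.

Lemma qinv_top (Q : qframe) : (stop : Q)^i = stop.
Proof.
apply: sle_anti; first exact: sle_top.
by rewrite -[X in X ⊑ _]qinvK; apply: qinv_mono; exact: sle_top.
Qed.

(** [R(Q)], the subframe of right-sided elements. *)
Section right_sided.
Variable Q : qframe.

Let rs (a : Q) := a ⋅ stop ⊑ a.
Let rs_sup (S : set Q) : (forall x, S x -> rs x) -> rs (⋁ S).
Proof.
move=> Srs; rewrite /rs qmul_supl; apply: ssup_le => _ [a Sa <-].
by apply: sle_trans (Srs _ Sa) _; exact: ssup_ub.
Qed.
Let rs_meet (x y : Q) : rs x -> rs y -> rs (x ⊓ y).
Proof.
move=> rx ry; apply: smeet_glb.
- by apply: sle_trans rx; apply: qmul_monol; exact: smeetl.
- by apply: sle_trans ry; apply: qmul_monol; exact: smeetr.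
Qed.

Definition RQ : frame := subframe rs_sup rs_meet.

Lemma RQ_meetE (x y : RQ) : sval (x ⊓ y) = sval x ⊓ sval y.
Proof. by rewrite (sub_meetE rs_meet). Qed.

Lemma RQ_topE : sval (stop : RQ) = stop.
Proof.
apply: sle_anti; first exact: sle_top.
exact: (@sle_top RQ (exist rs stop (sle_top (stop ⋅ stop))) : sle (s := Q) _ _).
Qed.

Program Definition dQ : locmap Q RQ := @LocMap Q RQ (fun z => sval z) _ _ _.
Next Obligation. by []. Qed.
Next Obligation. exact: RQ_meetE. Qed.
Next Obligation. exact: RQ_topE. Qed.

Program Definition rQ : locmap Q RQ := @LocMap Q RQ (fun z => (sval z)^i) _ _ _.
Next Obligation. by move=> S; rewrite /= qinv_sup image_comp. Qed.
Next Obligation. by move=> x y; cbv beta; rewrite RQ_meetE qinv_meet. Qed.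
Next Obligation. by cbv beta; rewrite RQ_topE qinv_top. Qed.

Program Definition iQ : locmap Q Q := @LocMap Q Q (@qinv Q) _ _ _.
Next Obligation. exact: qinv_sup. Qed.
Next Obligation. exact: qinv_meet. Qed.
Next Obligation. exact: qinv_top. Qed.

End right_sided.

Record bisection (Q : qframe) := Bisection {
  bdom : RQ Q;
  bsec : locmap (seg bdom) Q;
  bsec_dom : lm_eq (dQ Q ∘l bsec) (k_ bdom);
  bsec_open : lm_open (rQ Q ∘l bsec);
  bsec_mono : lm_regular_mono (rQ Q ∘l bsec) }.

Section bisections.
Variable Q : qframe.
Implicit Types (σ τ ρ : bisection Q) (a b x y : Q).

(** [s_σ^★ a], seen in [R(Q)]. *)
Definition bim σ a : RQ Q := sval ((bsec σ)^★ a).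

(** [ρ = σ τ] *)
Definition is_mul σ τ ρ : Prop :=
  bdom ρ = bim σ (sval (bdom τ))^i /\
  forall a, bim ρ a =
    ⋁ [set w | exists x y, x ⋅ y ⊑ a /\ w = bim σ (x ⊓ (sval (bim τ y))^i)].

(** [τ = σ⁻¹] *)
Definition is_inv σ τ : Prop :=
  exists (α : locmap (seg (bdom σ)) (seg (bdom τ)))
         (β : locmap (seg (bdom τ)) (seg (bdom σ))),
    [/\ lm_iso α β,
        lm_eq (rQ Q ∘l bsec σ) (k_ (bdom τ) ∘l α) &
        lm_eq (bsec τ) (iQ Q ∘l bsec σ ∘l β)].

Definition idem σ : Prop := is_mul σ σ σ.

(** The natural order: [σ] is the restriction of [τ] to [bdom σ]. *)
Definition ble σ τ : Prop :=
  bdom σ ⊑ bdom τ /\ forall a, bim σ a = bim τ a ⊓ bdom σ.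

Definition compatible σ τ : Prop :=
  (exists τ' ρ, [/\ is_inv τ τ', is_mul σ τ' ρ & idem ρ]) /\
  (exists σ' ρ, [/\ is_inv σ σ', is_mul σ' τ ρ & idem ρ]).

Definition is_join (B : set (bisection Q)) ρ : Prop :=
  (forall σ, B σ -> ble σ ρ) /\
  (forall τ, (forall σ, B σ -> ble σ τ) -> ble ρ τ).

Definition compatibly_closed (A : set (bisection Q)) : Prop :=
  (forall σ τ, A σ -> ble τ σ -> A τ) /\
  (forall B ρ, B `<=` A ->
     (forall σ τ, B σ -> B τ -> compatible σ τ) -> is_join B ρ -> A ρ).

(** [σ · a] *)
Definition bact σ a : Q :=
  ⋁ [set w | exists x y, x^i ⋅ y ⊑ a /\ w = sval (bim σ x) ⊓ y].

Lemma bim_le σ a : bim σ a ⊑ bdom σ.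
Proof. exact: (svalP ((bsec σ)^★ a)). Qed.

Lemma bim_meet σ a b : bim σ (a ⊓ b) = bim σ a ⊓ bim σ b.
Proof. by rewrite /bim invim_meet seg_meetE. Qed.

Lemma bim_sup σ (S : set Q) : bim σ (⋁ S) = ⋁ (bim σ @` S).
Proof. by rewrite /bim invim_sup seg_supE image_comp. Qed.

Lemma bim_top σ : bim σ stop = bdom σ.
Proof. by rewrite /bim invim_top seg_topE. Qed.

Lemma ble_refl σ : ble σ σ.
Proof.
split=> [|a]; first exact: sle_refl.
by rewrite smeet_idl //; exact: bim_le.
Qed.

Lemma ble_trans τ σ ρ : ble σ τ -> ble τ ρ -> ble σ ρ.
Proof.
move=> [d1 e1] [d2 e2]; split=> [|a]; first exact: (sle_trans d1 d2).
by rewrite e1 e2 -smeetA [X in _ ⊓ X]smeetC (smeet_idl d1).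
Qed.

Section restriction.
Variables (σ : bisection Q) (e : RQ Q).
Hypothesis eU : e ⊑ bdom σ.

Program Definition rsec : locmap (seg e) Q :=
  @LocMap (seg e) Q (fun a => (k_ e)^★ (bim σ a)) _ _ _.
Next Obligation. by move=> S; cbv beta; rewrite bim_sup invim_sup image_comp. Qed.
Next Obligation. by move=> x y; cbv beta; rewrite bim_meet invim_meet. Qed.
Next Obligation.
cbv beta; rewrite bim_top; apply: sig_inj; rewrite seg_topE /= smeetC.
exact: (smeet_idl eU).
Qed.

Let into (x : seg e) : seg (bdom σ) :=
  exist (fun z => z ⊑ bdom σ) (sval x) (sle_trans (svalP x) eU).

Lemma rsec_dom : lm_eq (dQ Q ∘l rsec) (k_ e).
Proof.
move=> z; apply: sig_inj => /=.
have /(congr1 sval) /= := bsec_dom σ z; rewrite /bim => ->.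
by rewrite -smeetA [X in _ ⊓ X]smeetC (smeet_idl eU).
Qed.

Lemma rsec_open : lm_open (rQ Q ∘l rsec).
Proof.
have [dir [adj frob]] := bsec_open σ.
exists (fun x : seg e => dir (into x)); split=> x y.
- split=> [/adj h|h]; first by apply: smeet_glb; [exact: h|exact: (svalP x)].
  by apply/adj; apply: sle_trans (h : sval x ⊑ _) _; exact: smeetl.
- rewrite -frob; congr dir; apply: sig_inj; rewrite [RHS]seg_meetE.
  rewrite -[LHS]/(sval (x ⊓ (rQ Q ∘l rsec)^★ y)) seg_meetE.
  have -> : sval ((rQ Q ∘l rsec)^★ y) = bim σ (sval y)^i ⊓ e by [].
  by rewrite [bim _ _ ⊓ e]smeetC smeetA (smeet_idl (svalP x)).
Qed.

Lemma rsec_mono : lm_regular_mono (rQ Q ∘l rsec).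
Proof.
apply/lm_regular_monoP => x.
have [y yE] := (lm_regular_monoP _).1 (bsec_mono σ) (into x).
exists y; apply: sig_inj; move/(congr1 sval): yE => /= yE.
by rewrite /bim yE; exact: smeet_idl (svalP x).
Qed.

Definition restr : bisection Q := Bisection rsec_dom rsec_open rsec_mono.

End restriction.

Lemma ble_restr σ e (eU : e ⊑ bdom σ) τ :
  ble τ σ -> bdom τ ⊑ e -> ble τ (restr eU).
Proof.
move=> [_ tE] te; split=> // a; rewrite tE [bim (restr eU) a]/=.
by rewrite -smeetA [X in _ = _ ⊓ X]smeetC (smeet_idl te).
Qed.

Lemma j_closed a : compatibly_closed [set σ | bim σ a = bdom σ].
Proof.
split=> [σ τ /= aE [tU ->]|B ρ BA _ [ub lub] /=].
  by rewrite aE smeetC (smeet_idl tU).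
apply: (@sle_anti (RQ Q)); first exact: bim_le.
suff /lub[] : forall σ, B σ -> ble σ (restr (bim_le ρ a)) by [].
move=> σ Bσ; apply: ble_restr; first exact: ub.
by have [_ sE] := ub _ Bσ; rewrite -(BA _ Bσ) sE; exact: smeetl.
Qed.

Lemma down_closed σ : compatibly_closed [set τ | ble τ σ].
Proof.
split=> [τ ρ /= ts rt|B ρ BA _ [_ lub] /=]; first exact: ble_trans rt ts.
by apply: lub => τ /BA.
Qed.

End bisections.

Section closed_sets.
Variables (T : Type) (P : set T -> Prop).
Hypothesis P_bigcap : forall F : set (set T),
  (forall A, F A -> P A) -> P [set t | forall A, F A -> A t].

(** The least closed set containing [X]. *)
Definition clset (X : set T) : {A : set T | P A} :=
  exist P [set t | forall A, (P A /\ X `<=` A) -> A t]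
    (P_bigcap (F := [set A | P A /\ X `<=` A]) (fun A h => proj1 h)).

Lemma sub_clset (X : set T) : X `<=` sval (clset X).
Proof. by move=> t Xt A [_]; apply. Qed.

Lemma clset_min (X : set T) (A : {A : set T | P A}) :
  X `<=` sval A -> sval (clset X) `<=` sval A.
Proof. by move=> XA t; apply; split=> //; exact: (svalP A). Qed.

Program Definition closed_suplat : suplat := @SupLat {A : set T | P A}
  (fun A B => sval A `<=` sval B)
  (fun F => clset [set t | exists2 A, F A & sval A t]) _ _ _ _ _.
Next Obligation. by move=> x t. Qed.
Next Obligation. by move=> y x z xy yz t /xy /yz. Qed.
Next Obligation. by move=> x y xy yx; apply: sig_inj; apply/seteqP; split. Qed.
Next Obligation. by move=> F A FA t At; apply: sub_clset; exists A. Qed.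
Next Obligation.
by move=> F B FB; apply: clset_min => t [A FA At]; exact: FB FA t At.
Qed.

End closed_sets.

(** [Q̂ = L^∨(Γ(Q))] *)
Section hat.
Variable Q : qframe.

Lemma compatibly_closed_bigcap (F : set (set (bisection Q))) :
  (forall A, F A -> compatibly_closed A) ->
  compatibly_closed [set σ | forall A, F A -> A σ].
Proof.
move=> Fcl; split=> [σ τ As ts A FA|B ρ BA Bc BJ A FA].
  by have [h _] := Fcl _ FA; apply: h ts; exact: As.
by have [_ h] := Fcl _ FA; apply: h BJ => // σ /BA; exact.
Qed.

Definition hat : suplat := closed_suplat compatibly_closed_bigcap.

Definition hat_mul (A B : hat) : hat :=
  clset compatibly_closed_bigcap
    [set ρ | exists σ τ, [/\ sval A σ, sval B τ & is_mul σ τ ρ]].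

Definition hat_down (σ : bisection Q) : hat := exist _ _ (down_closed σ).

Definition jQ (a : Q) : hat := exist _ _ (j_closed a).

End hat.

(** [tensor ra lb] is the tensor product of [A], with a right action [ra] of
    [R], and [B], with a left action [lb] of [R]: the lattice of those subsets
    of [A * B] that contain, with each [a ⊗ b], everything below it according
    to the relations of the tensor product.  [tensorP] below is its universal
    property. *)

Definition bimorphism (A B C : suplat) (R : Type) (ra : A -> R -> A)
    (lb : R -> B -> B) (f : A -> B -> C) : Prop :=
  [/\ forall S b, f (⋁ S) b = ⋁ [set f a b | a in S],
      forall a S, f a (⋁ S) = ⋁ [set f a b | b in S] &
      forall a z b, f (ra a z) b = f a (lb z b)].

Section tensor.
Variables (A B : suplat) (R : Type) (ra : A -> R -> A) (lb : R -> B -> B).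

Definition tensor_closed (X : set (A * B)) : Prop :=
  [/\ forall a a' b b', a ⊑ a' -> b ⊑ b' -> X (a', b') -> X (a, b),
      forall S b, (forall a, S a -> X (a, b)) -> X (⋁ S, b),
      forall a S, (forall b, S b -> X (a, b)) -> X (a, ⋁ S) &
      forall a z b, X (ra a z, b) <-> X (a, lb z b)].

Lemma tensor_closed_bigcap (F : set (set (A * B))) :
  (forall X, F X -> tensor_closed X) ->
  tensor_closed [set t | forall X, F X -> X t].
Proof.
move=> Fcl; split.
- move=> a a' b b' aa bb h X FX; have [c _ _ _] := Fcl _ FX.
  by apply: c aa bb _; exact: h.
- move=> S b h X FX; have [_ c _ _] := Fcl _ FX.
  by apply: c => a Sa; exact: h.
- move=> a S h X FX; have [_ _ c _] := Fcl _ FX.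
  by apply: c => b Sb; exact: h.
- move=> a z b; split=> h X FX; have [_ _ _ c] := Fcl _ FX;
  by apply/c; exact: h.
Qed.

Definition tensor : suplat := closed_suplat tensor_closed_bigcap.

Definition pure (a : A) (b : B) : tensor :=
  clset tensor_closed_bigcap [set (a, b)].

Lemma pure_le a b (X : tensor) : pure a b ⊑ X <-> sval X (a, b).
Proof.
split=> [h|Xab]; first by apply: h; exact: sub_clset.
by apply: clset_min => _ ->.
Qed.

Lemma pure_bimorphism : bimorphism ra lb pure.
Proof.
split.
- move=> S b; apply: sle_anti.
  + apply/pure_le; have [_ c _ _] := svalP (⋁ [set pure a b | a in S]).
    by apply: c => a Sa; apply/pure_le; apply: ssup_ub; exists a.
  + apply: ssup_le => _ [a Sa <-]; apply/pure_le.
    have [c _ _ _] := svalP (pure (⋁ S) b).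
    by apply: c (ssup_ub Sa) (sle_refl b) _; apply/pure_le; exact: sle_refl.
- move=> a S; apply: sle_anti.
  + apply/pure_le; have [_ _ c _] := svalP (⋁ [set pure a b | b in S]).
    by apply: c => b Sb; apply/pure_le; apply: ssup_ub; exists b.
  + apply: ssup_le => _ [b Sb <-]; apply/pure_le.
    have [c _ _ _] := svalP (pure a (⋁ S)).
    by apply: c (sle_refl a) (ssup_ub Sb) _; apply/pure_le; exact: sle_refl.
- move=> a z b; apply: sle_anti; apply/pure_le.
  + have [_ _ _ c] := svalP (pure a (lb z b)).
    by apply/c/pure_le; exact: sle_refl.
  + have [_ _ _ c] := svalP (pure (ra a z) b).
    by apply/c/pure_le; exact: sle_refl.
Qed.

Lemma tensor_gen (X : tensor) :
  X = ⋁ [set pure t.1 t.2 | t in sval X].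
Proof.
apply: sle_anti.
- move=> [a b] Xab; apply/pure_le; apply: ssup_ub.
  by exists (a, b).
- by apply: ssup_le => _ [[a b] Xab <-]; apply/pure_le.
Qed.

Lemma tensorP (C : suplat) (f : A -> B -> C) : bimorphism ra lb f ->
  exists g : suphom tensor C, (forall a b, g (pure a b) = f a b) /\
    forall h : suphom tensor C, (forall a b, h (pure a b) = f a b) -> h =1 g.
Proof.
move=> [fl fr fb].
have fmono a a' b b' : a ⊑ a' -> b ⊑ b' -> f a b ⊑ f a' b'.
  move=> aa bb; apply: (@sle_trans _ (f a' b)).
  - by rewrite -(ssup2 aa) fl; apply: ssup_ub; exists a => //; left.
  - by rewrite -(ssup2 bb) fr; apply: ssup_ub; exists b => //; left.
have below_cl (c : C) : tensor_closed [set t | f t.1 t.2 ⊑ c].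
  split=> /= [a a' b b' aa bb|S b h|a S h|a z b].
  - by apply: sle_trans; exact: fmono.
  - by rewrite fl; apply: ssup_le => _ [a Sa <-]; exact: h.
  - by rewrite fr; apply: ssup_le => _ [b Sb <-]; exact: h.
  - by rewrite fb.
pose below c : tensor := exist _ _ (below_cl c).
pose g (X : tensor) : C := ⋁ [set f t.1 t.2 | t in sval X].
have gadj X c : g X ⊑ c <-> X ⊑ below c.
  split=> [h t Xt|h].
  - by apply: sle_trans h; apply: ssup_ub; exists t.
  - by apply: ssup_le => _ [t Xt <-]; exact: (h t Xt).
have gsup (F : set tensor) : g (⋁ F) = ⋁ (g @` F).
  apply: sle_anti.
  - apply/gadj; apply: ssup_le => X FX; apply/gadj; apply: ssup_ub.
    by exists X.
  - apply: ssup_le => _ [X FX <-]; apply/gadj.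
    apply: sle_trans (ssup_ub FX) _; apply/gadj; exact: sle_refl.
have gpure a b : g (pure a b) = f a b.
  apply: sle_anti.
  - by apply/gadj/pure_le => /=; exact: sle_refl.
  - apply: ssup_ub; exists (a, b) => //; apply/pure_le; exact: sle_refl.
exists (SupHom gsup); split=> // h hE X.
rewrite [in LHS](tensor_gen X) supfun_sup image_comp /= /g.
by congr ssup; apply: eq_imagel => t _ /=.
Qed.

End tensor.

(** [f ⊗ id], the map sending [⋁ aᵢ ⊗ bᵢ] to [⋁ f aᵢ ⊗ bᵢ]. *)
Section tensor_map.
Variables (A A' B : suplat) (R : Type).
Variables (ra : A -> R -> A) (ra' : A' -> R -> A') (lb : R -> B -> B).

Definition tensor_map (f : A -> A') (X : tensor ra lb) : tensor ra' lb :=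
  ⋁ [set pure ra' lb (f t.1) t.2 | t in sval X].

Lemma tensor_mapP (f : suphom A A') :
    (forall a z, f (ra a z) = ra' (f a) z) ->
  (forall S, tensor_map f (⋁ S) = ⋁ (tensor_map f @` S)) /\
  (forall a b, tensor_map f (pure ra lb a b) = pure ra' lb (f a) b).
Proof.
move=> fz; have [pl pr pb] := pure_bimorphism ra' lb.
have bi : bimorphism ra lb (fun a b => pure ra' lb (f a) b).
  split=> [S b|a S|a z b]; last by rewrite fz pb.
  - by rewrite supfun_sup pl image_comp.
  - exact: pr.
have [g [gE _]] := tensorP bi.
have mE X : tensor_map f X = g X.
  rewrite [in RHS](tensor_gen X) supfun_sup image_comp /tensor_map.
  by congr ssup; apply: eq_imagel => t _ /=; rewrite gE.
split=> [S|a b]; last by rewrite mE gE.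
by rewrite mE supfun_sup; congr ssup; apply: eq_imagel => X _; rewrite mE.
Qed.

End tensor_map.

Definition sup_mono (L M : suplat) (f : L -> M) : Prop :=
  forall (N : suplat) (g h : suphom N L), f \o g =1 f \o h -> g =1 h.

Section embeddable.
Variable Q : qframe.

Definition Q_ract (a : Q) (z : RQ Q) : Q := a ⊓ (sval z)^i.
Definition Q_lact (z : RQ Q) (a : Q) : Q := a ⊓ sval z.
Definition hat_ract (A : hat Q) (z : RQ Q) : hat Q := A ⊓ jQ (sval z)^i.

Definition weakly_embeddable : Prop :=
  forall (σ : bisection Q) (a : Q),
    hat_mul (hat_down σ) (jQ a) = jQ (bact σ a).

Definition j_tensor_id : tensor Q_ract Q_lact -> tensor hat_ract Q_lact :=
  tensor_map hat_ract (@jQ Q).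

Definition embeddable : Prop := weakly_embeddable /\ sup_mono j_tensor_id.

End embeddable.

(** The multiplication [gmul] is total, with unspecified values outside the
    composable pairs; composition is written in diagrammatic order. *)
Record topGroupoid := TopGroupoid {
  obj : topologicalType;
  arr : topologicalType;
  gdom : arr -> obj;
  gcod : arr -> obj;
  gunit : obj -> arr;
  ginv : arr -> arr;
  gmul : arr -> arr -> arr;
  gdom_unit : forall a, gdom (gunit a) = a;
  gcod_unit : forall a, gcod (gunit a) = a;
  gdom_inv : forall x, gdom (ginv x) = gcod x;
  gcod_inv : forall x, gcod (ginv x) = gdom x;
  gdom_mul : forall x y, gcod x = gdom y -> gdom (gmul x y) = gdom x;
  gcod_mul : forall x y, gcod x = gdom y -> gcod (gmul x y) = gcod y;
  gmulA : forall x y z, gcod x = gdom y -> gcod y = gdom z ->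
    gmul x (gmul y z) = gmul (gmul x y) z;
  gmul_unitl : forall x, gmul (gunit (gdom x)) x = x;
  gmul_unitr : forall x, gmul x (gunit (gcod x)) = x;
  gmulxV : forall x, gmul x (ginv x) = gunit (gdom x);
  gmulVx : forall x, gmul (ginv x) x = gunit (gcod x);
  gdom_continuous : continuous gdom;
  gcod_continuous : continuous gcod;
  gunit_continuous : continuous gunit;
  ginv_continuous : continuous ginv;
  gmul_continuous : {within [set p : arr * arr | gcod p.1 = gdom p.2],
    continuous (fun p => gmul p.1 p.2)} }.

Definition composable (G : topGroupoid) : set (arr G * arr G) :=
  [set p | gcod p.1 = gdom p.2].

Section groupoid_algebra.
Variable G : topGroupoid.
Implicit Types x y : arr G.

Lemma ginvK : involutive (@ginv G).
Proof.
move=> x; rewrite -[RHS]gmul_unitl -[in RHS]gcod_inv -gmulVx.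
by rewrite -gmulA ?gcod_inv ?gdom_inv // gmulVx -gdom_inv -gcod_inv gmul_unitr.
Qed.

Lemma gmulKV x y : gdom x = gdom y -> gmul x (gmul (ginv x) y) = y.
Proof.
move=> xy; rewrite gmulA ?gdom_inv ?gcod_inv //.
by rewrite gmulxV xy gmul_unitl.
Qed.

Lemma gmulVK x y : gcod x = gdom y -> gmul (ginv x) (gmul x y) = y.
Proof. by move=> xy; rewrite gmulA ?gcod_inv // gmulVx xy gmul_unitl. Qed.

Lemma ginvM x y : gcod x = gdom y ->
  ginv (gmul x y) = gmul (ginv y) (ginv x).
Proof.
move=> xy; set z := gmul x y.
have dz : gdom z = gdom x by exact: gdom_mul.
have cz : gcod z = gcod y by exact: gcod_mul.
have yxz : gmul (gmul (ginv y) (ginv x)) z = gunit (gcod y).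
  rewrite -gmulA ?gcod_inv ?gdom_inv ?dz //.
  by rewrite gmulVK // gmulVx.
rewrite -[RHS]gmul_unitr gcod_mul ?gcod_inv ?gdom_inv //.
rewrite -dz -gmulxV gmulA ?gdom_inv ?gcod_mul ?gcod_inv ?gdom_inv //.
by rewrite yxz -cz -gdom_inv gmul_unitl.
Qed.

End groupoid_algebra.

Definition open_groupoid (G : topGroupoid) : Prop :=
  forall A : set (arr G), open A -> open (@gdom G @` A).

Section opens.
Variable T : topologicalType.

Program Definition opens_suplat : suplat := @SupLat {A : set T | open A}
  (fun A B => sval A `<=` sval B)
  (fun F => exist open (\bigcup_(A in F) sval A)
     (bigcup_open (fun A _ => svalP A))) _ _ _ _ _.
Next Obligation. by move=> A t. Qed.
Next Obligation. by move=> B A C AB BC t /AB /BC. Qed.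
Next Obligation. by move=> A B AB BA; apply: sig_inj; apply/seteqP; split. Qed.
Next Obligation. by move=> F A FA t At; exists A. Qed.
Next Obligation. by move=> F B FB t [A FA At]; exact: FB FA t At. Qed.

Lemma opens_meetE (A B : opens_suplat) : sval (A ⊓ B) = sval A `&` sval B.
Proof.
have AB := openI (svalP A) (svalP B).
have -> // : A ⊓ B = exist open (sval A `&` sval B) AB.
apply: sle_anti.
- have l := smeetl A B; have r := smeetr A B.
  by move=> t ABt; split; [exact: l|exact: r].
- by apply: smeet_glb => t [].
Qed.

Program Definition opens : frame := @Frame opens_suplat _.
Next Obligation.
move=> A F t; rewrite opens_meetE => -[At [B FB Bt]].
by exists (A ⊓ B); [exists B|rewrite opens_meetE].
Qed.

End opens.

Section groupoid_quantale.
Variables (G : topGroupoid) (G_open : open_groupoid G).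

Definition set_gmul (A B : set (arr G)) : set (arr G) :=
  [set z | exists x y, [/\ A x, B y, gcod x = gdom y & z = gmul x y]].

Lemma open_set_gmul (A B : set (arr G)) :
  open A -> open B -> open (set_gmul A B).
Proof.
move=> oA oB; rewrite openE => _ [x [y [Ax By xy ->]]].
set z := gmul x y; have dz : gdom z = gdom x by exact: gdom_mul.
have near_comp : \forall p \near ((ginv x : arr G, z) : arr G * arr G),
    gcod p.1 = gdom p.2 -> B (gmul p.1 p.2).
  have /subspace_continuousP/(_ (ginv x, z)) := @gmul_continuous G.
  rewrite /= gcod_inv dz => /(_ erefl) h.
  have yB : nbhs (gmul (ginv x) z) B.
    by rewrite /z gmulVK //; exact: open_nbhs_nbhs.
  exact: (h B yB).
have [[C D] [/= Cx Dz] CD] := near_comp.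
have : nbhs x (A `&` @ginv G @^-1` C).
  apply: filterI; first exact: open_nbhs_nbhs.
  exact: (@ginv_continuous G x).
rewrite nbhsE => -[E [oE Ex] EA].
have : nbhs z (D `&` @gdom G @^-1` (@gdom G @` E)).
  apply: filterI => //; apply: (@gdom_continuous G z).
  apply: open_nbhs_nbhs; split; first exact: G_open.
  by exists x => //; rewrite dz.
apply: filterS => w [Dw [x' Ex' xw]].
have [Ax' Cx'] := EA _ Ex'.
exists x', (gmul (ginv x') w); split=> //.
- by apply: (CD (ginv x', w)) => //=; rewrite gcod_inv.
- by rewrite gdom_mul ?gcod_inv ?gdom_inv.
- by rewrite gmulKV.
Qed.

Lemma open_set_ginv (A : set (arr G)) : open A -> open (@ginv G @` A).
Proof.
move=> oA; suff -> : @ginv G @` A = @ginv G @^-1` A.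
  by apply: open_comp => // x _; exact: ginv_continuous.
apply/seteqP; split=> [_ [x Ax <-] /=|x Ax]; first by rewrite ginvK.
by exists (ginv x) => //; rewrite ginvK.
Qed.

(** [O(G)] *)
Program Definition groupoid_quantale : qframe := @QFrame (opens (arr G))
  (fun A B => exist open (set_gmul (sval A) (sval B))
     (open_set_gmul (svalP A) (svalP B)))
  (fun A => exist open (@ginv G @` sval A) (open_set_ginv (svalP A)))
  _ _ _ _ _ _.
Next Obligation.
move=> A B C; apply: sig_inj; apply/seteqP; split => /=.
- move=> _ [x [_ [Ax [y [z [By Cz yz ->]]] + ->]]]; rewrite gdom_mul // => xy.
  exists (gmul x y), z; rewrite gcod_mul // gmulA //; split=> //.
  by exists x, y.
- move=> _ [_ [z [[x [y [Ax By xy ->]]] Cz + ->]]]; rewrite gcod_mul // => yz.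
  exists x, (gmul y z); rewrite gdom_mul // gmulA //; split=> //.
  by exists y, z.
Qed.
Next Obligation.
move=> F B; apply: sig_inj; apply/seteqP; split => /=.
- move=> _ [x [y [[A FA Ax] By xy ->]]].
  eexists; first by exists A; [exact: FA|reflexivity].
  by exists x, y.
- move=> _ [_ [A FA <-]] /= [x [y [Ax By xy ->]]].
  by exists x, y; split=> //; exists A.
Qed.
Next Obligation.
move=> A F; apply: sig_inj; apply/seteqP; split => /=.
- move=> _ [x [y [Ax [B FB By] xy ->]]].
  eexists; first by exists B; [exact: FB|reflexivity].
  by exists x, y.
- move=> _ [_ [B FB <-]] /= [x [y [Ax By xy ->]]].
  by exists x, y; split=> //; exists B.
Qed.
Next Obligation.
move=> A; apply: sig_inj; rewrite /= image_comp.
by rewrite -[RHS]image_id; apply: eq_imagel => x _ /=; rewrite ginvK.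
Qed.
Next Obligation.
move=> A B; apply: sig_inj; apply/seteqP; split => /=.
- move=> _ [_ [x [y [Ax By xy ->]]] <-].
  exists (ginv y), (ginv x); rewrite ginvM // gcod_inv gdom_inv; split=> //.
- move=> _ [_ [_ [[y By <-] [x Ax <-] + ->]]].
  rewrite gcod_inv gdom_inv => yx.
  by exists (gmul x y); [exists x, y|rewrite ginvM].
Qed.
Next Obligation.
move=> F; apply: sig_inj; apply/seteqP; split => /=.
- move=> _ [x [A FA Ax] <-].
  eexists; first by exists A; [exact: FA|reflexivity].
  by exists x.
- move=> _ [_ [A FA <-]] /= [x Ax <-].
  by exists x => //; exists A.
Qed.

End groupoid_quantale.

(** Openness of the domain map is part of what is asserted of a coverable
    groupoid, since [O(G)] is only a quantale when [G] is open. *)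
Definition coverable (G : topGroupoid) : Prop :=
  exists G_open : open_groupoid G, embeddable (groupoid_quantale G_open).

Section smooth.
Variable R : realType.

Fixpoint Ck (V W : normedModType R) (k : nat) (O : set V) (f : V -> W) : Prop :=
  match k with
  | 0%N => {in O, continuous f}
  | k'.+1 => (forall x, O x -> differentiable f x) /\
             forall v : V, Ck k' O (fun x => 'd f x v)
  end.

Definition smooth_in (V W : normedModType R) (O : set V) (f : V -> W) : Prop :=
  forall k, Ck k O f.

(** A homeomorphism from an open subset of [M] to an open subset of [V]; both
    functions are total, with unspecified values outside these subsets. *)
Record chart (V : normedModType R) (M : topologicalType) := Chart {
  cdom : set M;
  cmap : M -> V;
  cinv : V -> M;
  cdom_open : open cdom;
  cimg_open : open (cmap @` cdom);
  cmap_continuous : {in cdom, continuous cmap};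
  cinv_continuous : {in cmap @` cdom, continuous cinv};
  cmapK : {in cdom, cancel cmap cinv} }.

Definition is_atlas (V : normedModType R) (M : topologicalType)
    (A : set (chart V M)) : Prop :=
  (forall p : M, exists2 c, A c & cdom c p) /\
  (forall c c', A c -> A c' ->
     smooth_in (cmap c @` (cdom c `&` cdom c')) (cmap c' \o cinv c)).

Section prod_chart.
Variables (V W : normedModType R) (M N : topologicalType).
Variables (c : chart V M) (c' : chart W N).

Let D : set (M * N) := cdom c `*` cdom c'.
Let f (p : M * N) : V * W := (cmap c p.1, cmap c' p.2).
Let g (v : V * W) : M * N := (cinv c v.1, cinv c' v.2).

Let open_prod (S T : topologicalType) (A : set S) (B : set T) :
  open A -> open B -> open (A `*` B).
Proof.
move=> oA oB; rewrite openE => -[x y] [/= Ax By]; exists (A, B) => //=.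
by split; exact: open_nbhs_nbhs.
Qed.
Let imgE : f @` D = (cmap c @` cdom c) `*` (cmap c' @` cdom c').
Proof.
apply/seteqP; split=> [_ [[x y] [/= Dx Dy] <-]|[v w] [/= [x Dx <-] [y Dy <-]]].
- by split; [exists x|exists y].
- by exists (x, y).
Qed.

Program Definition prod_chart : chart (V * W)%type (M * N)%type :=
  @Chart _ _ D f g _ _ _ _ _.
Next Obligation. by apply: open_prod; exact: cdom_open. Qed.
Next Obligation. by rewrite imgE; apply: open_prod; exact: cimg_open. Qed.
Next Obligation.
move=> [x y]; rewrite inE => -[/= Dx Dy].
apply: cvg_pair => /=.
- apply: (cvg_comp fst); first exact: cvg_fst.
  by apply: cmap_continuous; rewrite inE.
- apply: (cvg_comp snd); first exact: cvg_snd.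
  by apply: cmap_continuous; rewrite inE.
Qed.
Next Obligation.
move=> [v w]; rewrite imgE inE => -[/= Dv Dw].
apply: cvg_pair => /=.
- apply: (cvg_comp fst); first exact: cvg_fst.
  by apply: cinv_continuous; rewrite inE.
- apply: (cvg_comp snd); first exact: cvg_snd.
  by apply: cinv_continuous; rewrite inE.
Qed.
Next Obligation.
move=> [x y]; rewrite inE => -[/= Dx Dy].
by rewrite /g /f /= !cmapK // inE.
Qed.

End prod_chart.

Definition prod_atlas (V W : normedModType R) (M N : topologicalType)
    (A : set (chart V M)) (B : set (chart W N)) :
    set (chart (V * W)%type (M * N)%type) :=
  [set prod_chart c c' | c in A & c' in B].

(** Smoothness of [f] on a subset [S] of [M]: in charts, [f] is locally the
    restriction to [S] of a smooth map defined on an open subset of [V].  When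
    [S] is open, or an embedded submanifold such as the set of composable
    pairs of a Lie groupoid, this is the usual notion. *)
Definition smooth_on (V W : normedModType R) (M N : topologicalType)
    (A : set (chart V M)) (B : set (chart W N)) (S : set M) (f : M -> N) : Prop :=
  {within S, continuous f} /\
  forall c c' p, A c -> B c' -> S p -> cdom c p -> cdom c' (f p) ->
    exists (O : set V) (F : V -> W),
      [/\ open O, O (cmap c p), smooth_in O F &
          forall q, S q -> cdom c q -> O (cmap c q) -> cdom c' (f q) ->
            cmap c' (f q) = F (cmap c q)].

Definition submersion (V W : normedModType R) (M N : topologicalType)
    (A : set (chart V M)) (B : set (chart W N)) (f : M -> N) : Prop :=
  forall c c' p, A c -> B c' -> cdom c p -> cdom c' (f p) ->
    forall w : W, exists v : V, 'd (cmap c' \o f \o cinv c) (cmap c p) v = w.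

End smooth.

(** A Lie groupoid with [n]-dimensional manifold of objects and
    [m]-dimensional manifold of arrows. *)
Record lieGroupoid (R : realType) (n m : nat) := LieGroupoid {
  lie_gpd :> topGroupoid;
  obj_atlas : set (chart 'rV[R]_n (obj lie_gpd));
  arr_atlas : set (chart 'rV[R]_m (arr lie_gpd));
  obj_hausdorff : hausdorff_space (obj lie_gpd);
  arr_hausdorff : hausdorff_space (arr lie_gpd);
  obj_atlasP : is_atlas obj_atlas;
  arr_atlasP : is_atlas arr_atlas;
  gdom_smooth : smooth_on arr_atlas obj_atlas setT (@gdom lie_gpd);
  gcod_smooth : smooth_on arr_atlas obj_atlas setT (@gcod lie_gpd);
  gunit_smooth : smooth_on obj_atlas arr_atlas setT (@gunit lie_gpd);
  ginv_smooth : smooth_on arr_atlas arr_atlas setT (@ginv lie_gpd);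
  gmul_smooth : smooth_on (prod_atlas arr_atlas arr_atlas) arr_atlas
    (@composable lie_gpd) (fun p => gmul p.1 p.2);
  gdom_submersion : submersion arr_atlas obj_atlas (@gdom lie_gpd) }.

(* Main.v *)
Require Import Defs.
From mathcomp Require Import all_boot reals.
From mathcomp Require Import all_order all_algebra.
From mathcomp Require Import all_classical topology normedtype derive.
From mathcomp Require Import interval_inference ring lra.
From mathcomp Require landau.

(** A local bisection of O(G) is given by locale maps, but since the spaces of
    objects and of arrows are Hausdorff it is determined by its graph: a set S
    of arrows on which d and r are injective and restrict to open maps
    ([graph_bisection]), and every such set is a graph ([set_bisection]).  On
    graphs all the operations are pointwise: the product of bisections is the
    product of sets of arrows ([is_mulP]), sigma . a consists of the z such
    that x^-1 z lies in a for the arrow x of the graph with d x = d z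
    ([bactE]), and j(a) consists of the bisections whose graph lies in a
    ([jQE]).

    Weak embeddability then holds for every open topological groupoid with
    Hausdorff spaces ([groupoid_weakly_embeddable]).  The inclusion of sigma
    j(a) in j(sigma . a) is immediate, and if the graph of rho is contained in
    sigma . a, then rho = sigma (sigma^-1 rho) where the graph of sigma^-1 rho
    is contained in a.

    That j (x) id is a monomorphism rests on two facts.  The first is that the
    tensor product of Q with itself is spatial, with the composable pairs (x,
    y) as points ([tensor_spatial]); this uses that the space of arrows is
    locally compact and that the space of objects is Hausdorff.  The second is
    that there is a bisection through every arrow.  An element Y of the tensor
    product covers some composable pairs, and the pairs (A, b) such that all
    composable (x, y), with x on a bisection in A and y in b, are covered by Y
    form an element of the tensor product of the completion with Q
    ([covered_closed]).  It contains (j a', b') for all (a', b') in Y, and if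
    it contains (j a, b) then Y covers every composable pair in a * b, because
    the first component of such a pair lies on a bisection in j(a).  Hence (a,
    b) is in Y by spatiality, that is, j (x) id reflects the order
    ([j_tensor_id_reflects]).

    It remains to find a bisection through each arrow x of a Lie groupoid
    ([lie_bisection_through]); that d is open follows.  In a chart d and r are
    submersions to an n-dimensional space, so the kernels of their derivatives
    at x have a common complement ([common_section]).  The slice through
    x in the direction of this complement is a bisection near x by the inverse
    function theorem, applied to d and to r on the slice
    ([slice_inverse_function]). *)

Set Implicit Arguments.
Unset Strict Implicit.
Unset Printing Implicit Defensive.

Import Order.TTheory GRing.Theory Num.Theory.
Import numFieldNormedType.Exports.

Local Open Scope classical_set_scope.
Local Open Scope ring_scope.

(** * The inverse function theorem on slices *)

Lemma mx_entry_le (R : realType) m n (M : 'M[R]_(m, n)) i j : `|M i j| <= `|M|.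
Proof.
rewrite [leRHS]/Num.norm /= mx_normrE.
exact: (le_bigmax _ (fun k : 'I_m * 'I_n => `|M k.1 k.2|) (i, j)).
Qed.

Lemma mx_norm_le (R : realType) m n (M : 'M[R]_(m, n)) (c : R) :
  0 <= c -> (forall i j, `|M i j| <= c) -> `|M| <= c.
Proof.
move=> c0 Mc; rewrite [leLHS]/Num.norm /= mx_normrE.
by apply/bigmax_leP; split=> // -[i j] _; exact: Mc.
Qed.

(** In a space whose closed balls are compact a contraction of a closed ball has
    a fixed point: the point that is moved least. *)
Definition compact_balls (R : realType) (V : normedModType R) :=
  forall (x : V) (e : R), compact [set y : V | `|y - x| <= e].

Lemma rV_compact_balls (R : realType) n : compact_balls 'rV[R]_n.
Proof.
move=> x e; have [e0|e0] := ltP 0 e; last first.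
  have [->|/eqP e1] := eqVneq e 0.
    rewrite (_ : mkset _ = [set x]); first exact: compact_set1.
    apply/seteqP; split=> [y /=|_ ->]; last by rewrite /= subrr normr0.
    by rewrite normr_le0 subr_eq0 => /eqP.
  rewrite (_ : mkset _ = set0); first exact: compact0.
  apply/seteqP; split=> // y /= /(le_trans (normr_ge0 _)) e2.
  by apply: e1; apply/eqP; rewrite eq_le e0.
rewrite (_ : mkset _ = closed_ball x e); last first.
  rewrite closed_ballE //.
  by apply/seteqP; split=> y; rewrite /closed_ball_ /= distrC.
apply: bounded_closed_compact; last exact: closed_ball_closed.
exists (`|x| + e); split; first exact: num_real.
move=> M Mlt y; rewrite closed_ballE // /closed_ball_ /= distrC => xy.
apply: le_trans (ltW Mlt).
by rewrite -(subrK x y) addrC (le_trans (ler_normD _ _))// lerD2l.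
Qed.

Lemma half_contraction_fixed_point (R : realType) (V : normedModType R)
    (x0 : V) (e : R) (T : V -> V) : compact_balls V ->
  0 < e ->
  (forall x y, `|x - x0| <= e -> `|y - x0| <= e ->
     `|T x - T y| <= 2^-1 * `|x - y|) ->
  (forall x, `|x - x0| <= e -> `|T x - x0| <= e) ->
  exists2 x, `|x - x0| <= e & T x = x.
Proof.
move=> cV e0 Tlip Tself; pose K : set V := [set x | `|x - x0| <= e].
have cT : {within K, continuous (fun x => `|x - T x|)}.
  apply/subspace_continuousP => x Kx; apply: cvg_norm; apply: cvgB.
    exact: cvg_within.
  apply/cvgrPdist_le => d d0; near=> y.
  have Ky : K y by near: y; exact: withinT.
  apply: le_trans (Tlip _ _ Kx Ky) _.
  rewrite (_ : d = 2^-1 * (2 * d)); last by field.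
  rewrite ler_pM2l ?invr_gt0//; near: y; apply: cvg_within.
  by apply: cvgr_dist_le; [exact: cvg_id|rewrite mulr_gt0].
(* The point that T moves least is fixed, since T x is moved by half as much. *)
have [|x /set_mem Kx xmin] := compact_EVT_min _ (cV x0 e) cT.
  by exists x0; rewrite /= subrr normr0 ltW.
exists x => //; apply/eqP; rewrite eq_sym -subr_eq0 -normr_eq0.
have := xmin (T x); rewrite inE => /(_ (Tself _ Kx)) le1.
have le2 := Tlip _ _ Kx (Tself _ Kx).
have := normr_ge0 (x - T x); lra.
Unshelve. all: by end_near. Qed.

Lemma near_id_inj (R : realType) (V : normedModType R) (g : V -> V) (N : set V) :
  (forall x y, N x -> N y ->
     `|(x - g x) - (y - g y)| <= 2^-1 * `|x - y|) ->
  forall x y, N x -> N y -> g x = g y -> x = y.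
Proof.
move=> lip x y Nx Ny gxy; apply/eqP; rewrite -subr_eq0 -normr_eq0.
have := lip _ _ Nx Ny; rewrite gxy opprB addrA subrK.
have := normr_ge0 (x - y); lra.
Qed.

(** If x - g x is a contraction on N, then to solve g x = y near x0 amounts to
    finding a fixed point of x |-> x - g x + y, which maps a closed ball around
    x0 to itself when y is close to g x0. *)
Lemma near_id_open (R : realType) (V : normedModType R) (g : V -> V) (N : set V) :
  compact_balls V ->
  (forall x y, N x -> N y ->
     `|(x - g x) - (y - g y)| <= 2^-1 * `|x - y|) ->
  forall P, open P -> P `<=` N -> open (g @` P).
Proof.
move=> cV lip P oP PN; rewrite openE => _ [x0 Px0 <-].
have [e /= e0 eP] : exists2 e : R, 0 < e & forall x, `|x - x0| <= e -> P x.
  have /nbhs_closedballP [e eP] : nbhs x0 P by exact: open_nbhs_nbhs.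
  exists (e%:num) => // x xe; apply: eP; rewrite closed_ballE //.
  by rewrite /closed_ball_ /= distrC.
apply/nbhs_ballP; exists (e / 2); first by rewrite /= divr_gt0.
move=> y; rewrite -ball_normE /= => /ltW ye.
have NP x : `|x - x0| <= e -> N x by move=> /eP /PN.
have [||x xe Tx] :=
  @half_contraction_fixed_point R V x0 e (fun x => x - g x + y) cV e0.
- move=> x x' xe xe'; rewrite opprD addrACA subrr addr0.
  by apply: lip; exact: NP.
- move=> x xe.
  have -> : x - g x + y - x0 = ((x - g x) - (x0 - g x0)) + (y - g x0).
    by rewrite opprB -[RHS]addrA [X in _ = _ + X]addrC subrKA addrA.
  apply: le_trans (ler_normD _ _) _; rewrite [leRHS]splitr; apply: lerD.
    apply: le_trans (lip _ _ (NP _ xe) (NP _ _)) _; last first.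
      by rewrite mulrC ler_pM2r ?invr_gt0.
    by rewrite subrr normr0 ltW.
  by rewrite distrC.
- exists x; first exact: eP.
  move: Tx; rewrite -addrA -[RHS]addr0 => /addrI/eqP.
  by rewrite addrC subr_eq0 => /eqP.
Qed.

(** For the supremum norm on the target it suffices to apply the mean value
    theorem to each coordinate. *)
Lemma mean_value_le (R : realType) (V : normedModType R) n (f : V -> 'rV[R]_n)
    (x u : V) (c : R) :
  0 <= c ->
  (forall t : R, 0 <= t <= 1 ->
     differentiable f (x + t *: u) /\ `|'d f (x + t *: u) u| <= c) ->
  `|f (x + u) - f x| <= c.
Proof.
move=> c0 df; apply: mx_norm_le => // i j; rewrite (ord1 i) => {i}.
pose l := fun t : R => x + t *: u.
have dl (t : R) : is_diff t l (fun h => h *: u).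
  by rewrite /l; apply: is_diff_eq; rewrite funeqE => h; rewrite /= add0r.
have dfl (t : R) : 0 <= t <= 1 -> is_diff t (f \o l) (fun h => 'd f (l t) (h *: u)).
  move=> /df[ft _]; rewrite -/(l t) in ft.
  apply: is_diff_eq; first apply: is_diff_comp; last by [].
  exact: differentiableP.
have dg (t : R) : 0 <= t <= 1 ->
    is_derive t 1 (fun s => f (l s) 0 j) ('d f (l t) u 0 j).
  move=> t01; have dfv : derivable (f \o l) t 1.
    by apply: diff_derivable; case: (dfl t t01).
  apply: DeriveDef; first by move/derivable_mxP: dfv; apply.
  have /(congr1 (fun M : 'rV_n => M 0 j)) := derive_mx dfv; rewrite mxE => <-.
  rewrite deriveE; last by case: (dfl t t01).
  by rewrite (@diff_val _ _ _ _ _ _ _ (dfl t t01)) scale1r.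
have [||t t01] := @MVT_segment R (fun s => f (l s) 0 j)
  (fun t => 'd f (l t) u 0 j) 0 1 ler01.
- by move=> t /itvP t01; apply: dg; rewrite !ltW ?t01.
- apply: derivable_within_continuous => t; rewrite in_itv /= => t01.
  by case: (dg t t01).
rewrite subr0 mulr1 /l scale1r scale0r addr0 !mxE => ->.
apply: le_trans (mx_entry_le _ _ _) _; rewrite in_itv /= in t01.
by case: (df t t01).
Qed.

Lemma continuous_dist_le (R : realType) (V W : normedModType R) (f : V -> W)
    (x : V) (l : W) (e : R) :
  {for x, continuous f} -> f x = l -> 0 < e -> nbhs x (fun y => `|l - f y| <= e).
Proof. by move=> /cvgrPdist_le fx <- /fx. Qed.

Lemma near_forall (T : topologicalType) (x : T) (I : finType) (P : I -> set T) :
  (forall i, nbhs x (P i)) -> nbhs x (fun y => forall i, P i y).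
Proof. exact: filter_forall. Qed.

Lemma mulmxr_continuous (R : realType) m n (A : 'M[R]_(m, n)) :
  continuous (fun w : 'rV[R]_m => w *m A).
Proof.
apply: (@bounded_linear_continuous _ _ _ (mulmxr A)); apply/linear_boundedP.
exists (m%:R * `|A|); split; first exact: num_real.
move=> M /ltW leM w; apply: (@le_trans _ _ (m%:R * `|A| * `|w|)); last first.
  by rewrite ler_wpM2r.
apply: mx_norm_le => [|i j]; first by rewrite !mulr_ge0.
rewrite mxE (le_trans (ler_norm_sum _ _ _)) //.
have -> : m%:R * `|A| * `|w| = \sum_(k < m) `|w| * `|A|.
  by rewrite sumr_const card_ord -mulr_natl; ring.
by apply: ler_sum => k _; rewrite normrM ler_pM // mx_entry_le.
Qed.

(** The derivative of w |-> w - f w vanishes at w0 and is continuous at w0 in each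
    of the n directions of the basis, so it is small on a ball around w0; as the
    ball is convex, the mean value theorem turns this into a Lipschitz bound. *)
Lemma C1_near_id (R : realType) n (f : 'rV[R]_n -> 'rV[R]_n) (O : set 'rV[R]_n) w0 :
  open O -> O w0 -> (forall w, O w -> differentiable f w) ->
  (forall v : 'rV[R]_n, {for w0, continuous (fun w : 'rV[R]_n => 'd f w v)}) ->
  (forall v : 'rV[R]_n, 'd f w0 v = v) ->
  exists2 d : R, 0 < d & ball w0 d `<=` O /\
    forall x y, ball w0 d x -> ball w0 d y ->
      `|(x - f x) - (y - f y)| <= 2^-1 * `|x - y|.
Proof.
move=> oO Ow df cdf df0.
(* n directions contribute at most e each, and n * e <= 1/2. *)
pose e : R := (2 * n.+1%:R)^-1.
have e0 : 0 < e by rewrite invr_gt0.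
have /nbhs_ballP[d /= d0 dP] : \forall w \near w0, O w /\
    forall j : 'I_n, `|delta_mx 0 j - 'd f w (delta_mx 0 j)| <= e.
  apply: filterI; first exact: open_nbhs_nbhs.
  apply: near_forall => j.
  exact: (continuous_dist_le (cdf (delta_mx 0 j)) (df0 _) e0).
exists d => //; split=> [w /dP[] //|x y wx wy].
have seg (t : R) : 0 <= t <= 1 -> ball w0 d (y + t *: (x - y)).
  case/andP=> t0 t1; move: wx wy; rewrite -!ball_normE /= => wx wy.
  have -> : w0 - (y + t *: (x - y)) = (1 - t) *: (w0 - y) + t *: (w0 - x).
    rewrite scalerBl scale1r !scalerBr opprD opprB addrA.
    by rewrite [in RHS]opprB -[RHS]addrA subrKA.
  apply: (le_lt_trans (ler_normD _ _)); rewrite !normrZ ger0_norm ?subr_ge0 //.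
  rewrite (ger0_norm t0) //; set a := `|w0 - y|; set b := `|w0 - x|.
  have ltM : Num.max a b < d by rewrite gt_max wy.
  apply: le_lt_trans ltM; set M := Num.max a b.
  have h1 : 0 <= (1 - t) * (M - a) by rewrite mulr_ge0 ?subr_ge0 // le_max lexx.
  have h2 : 0 <= t * (M - b) by rewrite mulr_ge0 ?subr_ge0 // le_max lexx orbT.
  lra.
pose g := fun w => w - f w.
have := @mean_value_le R _ n g y (x - y) (2^-1 * `|x - y|).
rewrite subrKC; apply; first by rewrite mulr_ge0.
move=> t /seg/dP[Ot dt]; set z := y + t *: (x - y) in Ot dt *.
have dg : is_diff z g (fun v => v - 'd f z v).
  have dfz : is_diff z f ('d f z) by apply: differentiableP; exact: df.
  exact: is_diff_eq.
split; first by case: dg.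
rewrite diff_val; set u := x - y.
rewrite [X in 'd f z X]row_sum_delta linear_sum [X in X - _]row_sum_delta -sumrB.
rewrite (le_trans (ler_norm_sum _ _ _)) //.
apply: (@le_trans _ _ (\sum_(j < n) (`|u| * e))).
  apply: ler_sum => j _; rewrite linearZ -scalerBr normrZ ler_pM //.
  exact: mx_entry_le.
rewrite sumr_const card_ord -[_ *+ n]mulr_natr -mulrA mulrC ler_wpM2r //.
by rewrite /e invfM -mulrA ler_piMr ?invr_ge0 // ler_pdivrMl ?mulr1 ?ler_nat.
Qed.

Lemma continuous_at_comp (S T U : topologicalType) (f : S -> T) (g : T -> U)
    (x : S) : {for x, continuous f} -> {for f x, continuous g} ->
  {for x, continuous (fun y => g (f y))}.
Proof. exact: continuous_comp. Qed.

Lemma near_eq_continuous (T U : topologicalType) (f g : T -> U) (x : T) :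
  {for x, continuous f} -> nbhs x (fun y => f y = g y) -> {for x, continuous g}.
Proof.
move=> cf fg; rewrite /prop_for /continuous_at -(nbhs_singleton fg).
exact: cvg_trans (near_eq_cvg fg) cf.
Qed.

Lemma open_nbhs_near (T : topologicalType) (A : set T) (x : T) (P : T -> Prop) :
  open A -> A x -> (forall y, A y -> P y) -> nbhs x P.
Proof. by move=> oA Ax AP; apply: filterS AP _; exact: open_nbhs_nbhs. Qed.

Lemma is_diff_mulmxr (R : realType) m n (A : 'M[R]_(m, n)) (w : 'rV[R]_m) :
  is_diff w (fun v : 'rV[R]_m => v *m A) (fun v : 'rV[R]_m => v *m A).
Proof.
have cA : continuous (mulmxr A : 'rV[R]_m -> 'rV[R]_n) by exact: mulmxr_continuous.
apply: DiffDef; first exact: (@linear_differentiable _ _ _ (mulmxr A)).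
exact: (@diff_lin _ _ _ (mulmxr A)).
Qed.

Lemma is_diff_affine (R : realType) m n (v0 : 'rV[R]_n) (L : 'M[R]_(m, n)) w :
  is_diff w (fun w : 'rV[R]_m => v0 + w *m L) (fun w : 'rV[R]_m => w *m L).
Proof.
have dm := is_diff_mulmxr L w.
by apply: is_diff_eq; rewrite funeqE => h; rewrite /= add0r.
Qed.

Lemma affine_continuous (R : realType) m n (v0 : 'rV[R]_n) (L : 'M[R]_(m, n)) :
  continuous (fun w : 'rV[R]_m => v0 + w *m L).
Proof.
by move=> w; apply: differentiable_continuous; case: (is_diff_affine v0 L w).
Qed.

(** The inverse function theorem for the restriction of F to the slice through
    v0 spanned by the rows of L.  Composing F with the inverse of the derivative
    M of this restriction makes the derivative at 0 the identity. *)
Lemma slice_inverse_function (R : realType) m n (F : 'rV[R]_m -> 'rV[R]_n)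
    (O : set 'rV[R]_m) (v0 : 'rV[R]_m) (L : 'M[R]_(n, m)) :
  open O -> O v0 -> Ck 1 O F -> L *m lin1_mx ('d F v0) \in unitmx ->
  exists2 d : R, 0 < d &
    [/\ forall w, ball (0 : 'rV[R]_n) d w -> O (v0 + w *m L),
        forall w w', ball (0 : 'rV[R]_n) d w -> ball (0 : 'rV[R]_n) d w' ->
          F (v0 + w *m L) = F (v0 + w' *m L) -> w = w' &
        forall P, open P -> P `<=` ball (0 : 'rV[R]_n) d ->
          open [set F (v0 + w *m L) | w in P]].
Proof.
move=> oO Ov [/= dF cdF]; set M := L *m _ => uM.
pose l (w : 'rV[R]_n) : 'rV[R]_m := v0 + w *m L.
have dl w : is_diff w l (fun w => w *m L) by exact: is_diff_affine.
have cl : continuous l by exact: affine_continuous.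
pose f (w : 'rV[R]_n) : 'rV[R]_n := F (l w) *m invmx M.
have df w : O (l w) -> is_diff w f (fun v => 'd F (l w) (v *m L) *m invmx M).
  move=> Olw; have dFl : is_diff w (F \o l) (fun v => 'd F (l w) (v *m L)).
    apply: is_diff_eq; first apply: is_diff_comp; last by [].
    by apply: differentiableP; exact: dF.
  have := @is_diff_comp _ _ _ _ _ _ _ _ _ dFl (is_diff_mulmxr (invmx M) _).
  exact.
have l0 : l 0 = v0 by rewrite /l mul0mx addr0.
have oOl : open (l @^-1` O) by apply: open_comp => // w _; exact: cl.
have [|||||d d0 [dO lip]] := @C1_near_id R n f (l @^-1` O) 0.
- exact: oOl.
- by rewrite /= l0.
- by move=> w /df[].
- move=> v; have cF : {for l 0, continuous (fun x => 'd F x (v *m L))}.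
    by apply: cdF; rewrite inE l0.
  have cFl := @continuous_at_comp _ _ _ l _ 0 (cl 0) cF.
  have cM := @mulmxr_continuous R n n (invmx M) ('d F (l 0) (v *m L)).
  have {cFl cM}cFl := @continuous_at_comp 'rV[R]_n 'rV[R]_n 'rV[R]_n
    (fun w => 'd F (l w) (v *m L)) (fun y => y *m invmx M) 0 cFl cM.
  apply: (@near_eq_continuous 'rV[R]_n 'rV[R]_n _ (fun w => 'd f w v) 0 cFl).
  apply: (open_nbhs_near oOl); first by rewrite /= l0.
  by move=> w /= Olw; rewrite (@diff_val _ _ _ _ _ _ _ (df w Olw)).
- move=> v; have Ol0 : O (l 0) by rewrite l0.
  have := @diff_val _ _ _ _ _ _ _ (df 0 Ol0) => ->.
  rewrite l0 -[X in X *m _](mul_rV_lin1 ('d F v0)) -(mulmxA v).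
  exact: mulmxK.
exists d => //; split=> [w /dO //|w w' wd wd' ww'|P oP Pd].
  by apply: (near_id_inj lip wd wd'); rewrite /f /l ww'.
have oF : open (f @` P).
  by apply: near_id_open lip _ oP Pd; exact: rV_compact_balls.
suff -> : [set F (v0 + w *m L) | w in P] =
    (fun y : 'rV[R]_n => y *m invmx M) @^-1` (f @` P).
  by apply: open_comp oF => y _; exact: mulmxr_continuous.
apply/seteqP; split=> [_ [w Pw <-]|y [w Pw fw]] /=; first by exists w.
by exists w => //; rewrite -[RHS](mulmxKV uM) -fw /f mulmxKV.
Qed.

(** If S is a section of A and T one of B, then S + t T is a section of both up
    to invertible matrices for all but finitely many t: the determinant of
    (S + t T) A is a polynomial in t with value 1 at 0, and that of (S + t T) B
    is a monic polynomial in t. *)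
Lemma common_section (K : numFieldType) m n (A B : 'M[K]_(m, n)) :
  row_full A -> row_full B ->
  exists L : 'M[K]_(n, m), L *m A \in unitmx /\ L *m B \in unitmx.
Proof.
move=> /row_fullP[S SA] /row_fullP[T TB].
pose p := \det (1%:M + 'X *: map_mx polyC (T *m A)).
pose q := char_poly (- (S *m B)).
have evC t (M : 'M[K]_n) : map_mx (horner_eval t) (map_mx polyC M) = M.
  by apply/matrixP => i j; rewrite !mxE horner_evalE hornerC.
have pE t : p.[t] = \det ((S + t *: T) *m A).
  rewrite -horner_evalE -det_map_mx map_mxD map_scalar_mx map_mxZ /= evC.
  by rewrite rmorph1 horner_evalE hornerX mulmxDl SA -scalemxAl.
have qE t : q.[t] = \det ((S + t *: T) *m B).
  rewrite -horner_evalE /q /char_poly -det_map_mx map_mxB map_scalar_mx /= evC.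
  by rewrite horner_evalE hornerX mulmxDl -scalemxAl TB opprK addrC scalemx1.
have pq0 : p * q != 0.
  rewrite mulf_neq0 ?(monic_neq0 (char_poly_monic _)) //.
  apply/eqP => p0; have := pE 0; rewrite p0 horner0 scale0r addr0 SA det1.
  by move/esym/eqP; rewrite oner_eq0.
pose rs : seq K := [seq k%:R | k <- iota 0 (size (p * q))].
have /allPn[t _] : ~~ all (root (p * q)) rs.
  apply/negP => roots; have := max_poly_roots pq0 roots.
  rewrite map_inj_uniq ?iota_uniq; last first.
    by move=> i j /eqP; rewrite eqr_nat => /eqP.
  by rewrite size_map size_iota ltnn => /(_ isT).
rewrite rootE hornerM mulf_eq0 negb_or pE qE => /andP[pt qt].
by exists (S + t *: T); rewrite !unitmxE !unitfE.
Qed.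

(** * Maps in charts *)

Lemma near_eq_diff (R : numFieldType) (V W : normedModType R) (f g : V -> W)
    (x : V) :
  nbhs x (fun y => f y = g y) -> differentiable f x ->
  'd g x = 'd f x :> (V -> W).
Proof.
move=> fg df; have /diff_locally/landau.eqaddoP fE := df.
have fg0 : \forall h \near 0, f (h + x) = g (h + x).
  have : \forall y \near x, f y = g y by [].
  by rewrite (near_shift 0) subr0.
apply: diff_unique; first exact: diff_continuous.
apply/landau.eqaddoP => e /fE; apply: filter_app; apply: filterS fg0 => h fgh.
by rewrite /= -(nbhs_singleton fg) -[(g \o _ - _) h]/(g (h + x) - _) -fgh.
Qed.

Lemma open_in_preimage (T U : topologicalType) (D : set T) (f : T -> U)
    (P : set U) :
  open D -> {in D, continuous f} -> open P -> open (D `&` f @^-1` P).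
Proof.
move=> oD cf oP; rewrite openE => x [Dx Px]; apply: filterI.
  exact: open_nbhs_nbhs.
by apply: cf; [rewrite inE|exact: open_nbhs_nbhs].
Qed.

Section chart_representation.
Variables (R : realType) (V W : normedModType R) (M N : topologicalType).
Variables (c : chart V M) (c' : chart W N).

Lemma chart_image_open (P : set M) : open P -> open (cmap c @` (cdom c `&` P)).
Proof.
move=> oP; have -> : cmap c @` (cdom c `&` P) =
    (cmap c @` cdom c) `&` cinv c @^-1` P.
  apply/seteqP; split=> [_ [x [cx Px] <-]|_ [[x cx <-]]].
    by split; [exact: imageP|rewrite /= cmapK // inE].
  by rewrite /= cmapK ?inE // => Px; exists x.
exact: open_in_preimage (cimg_open c) (@cinv_continuous _ _ _ c) oP.
Qed.

Lemma cmap_inj (x y : M) : cdom c x -> cdom c y -> cmap c x = cmap c y -> x = y.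
Proof.
by move=> cx cy xy; rewrite -(cmapK (mem_set cx)) xy cmapK // inE.
Qed.

(** The local expression of f in the two charts.  Asking it to be valid on all of
    O lets such expressions be composed ([chart_rep_comp]). *)
Definition chart_rep (f : M -> N) (O : set V) (F : V -> W) : Prop :=
  [/\ open O, Ck 1 O F, O `<=` cmap c @` cdom c,
      forall v, O v -> cdom c' (f (cinv c v)) &
      forall v, O v -> F v = cmap c' (f (cinv c v))].

Lemma smooth_chart_rep (A : set (chart V M)) (B : set (chart W N)) f p :
  continuous f -> smooth_on A B setT f -> A c -> B c' ->
  cdom c p -> cdom c' (f p) ->
  exists O F, chart_rep f O F /\ O (cmap c p).
Proof.
move=> cf [_ sf] Ac Bc' cp cfp.
have [O [F [oO Op sF FE]]] := sf _ _ _ Ac Bc' I cp cfp.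
pose O' := O `&` cmap c @` (cdom c `&` f @^-1` cdom c').
exists O', F; split; last by split=> //; exists p.
split.
- apply: openI => //; apply: chart_image_open.
  by apply: open_comp; [move=> x _; exact: cf|exact: cdom_open].
- have [dF cF] := sF 1%N; split=> [x [/dF]//|v x].
  by rewrite inE => -[Ox _]; apply: cF; rewrite inE.
- by move=> _ [_ [x [cx _] <-]]; exists x.
- by move=> _ [_ [x [cx cfx] <-]]; rewrite cmapK // inE.
- by move=> v [Ov [x [cx cfx] xv]]; rewrite -xv in Ov *; rewrite cmapK ?inE // FE.
Qed.

Lemma chart_rep_near f O F v : chart_rep f O F -> O v ->
  nbhs v (fun u => F u = (cmap c' \o f \o cinv c) u).
Proof.
by case=> oO _ _ _ FE Ov; apply: filterS FE _; exact: open_nbhs_nbhs.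
Qed.

Lemma chart_rep_differentiable f O F v : chart_rep f O F -> O v ->
  differentiable F v.
Proof. by case=> _ [dF _] _ _ _; exact: dF. Qed.

Lemma chart_rep_surj (A : set (chart V M)) (B : set (chart W N)) f O F p :
  submersion A B f -> A c -> B c' -> cdom c p -> cdom c' (f p) ->
  chart_rep f O F -> O (cmap c p) ->
  forall w, exists v, 'd F (cmap c p) v = w.
Proof.
move=> sf Ac Bc' cp cfp rF Op w.
have [v vE] := sf _ _ _ Ac Bc' cp cfp w; exists v; rewrite -vE.
have e := near_eq_diff (chart_rep_near rF Op) (chart_rep_differentiable rF Op).
exact: (congr1 (fun h : V -> W => h v) (esym e)).
Qed.

End chart_representation.

Lemma chart_rep_comp (R : realType) (V W X : normedModType R)
    (M N K : topologicalType) (c : chart V M) (c' : chart W N) (c'' : chart X K)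
    f g O F O' F' v : chart_rep c c' f O F -> chart_rep c' c'' g O' F' ->
  O v -> O' (F v) ->
  nbhs v (fun u => (F' \o F) u = (cmap c'' \o (g \o f) \o cinv c) u).
Proof.
move=> rF rF' Ov O'v; have [oO [dF _] _ cf FE] := rF.
have [oO' _ _ _ FE'] := rF'.
have : nbhs v (O `&` F @^-1` O').
  apply: filterI; first exact: open_nbhs_nbhs.
  by apply: (differentiable_continuous (dF _ Ov)); exact: open_nbhs_nbhs.
apply: filterS => u [Ou O'u] /=.
by rewrite FE' // FE // cmapK // inE; exact: cf.
Qed.

Lemma chart_locally_compact (R : realType) (V : normedModType R)
    (M : topologicalType) (c : chart V M) (x : M) (A : set M) :
  compact_balls V -> cdom c x -> open A -> A x ->
  exists K : set M, [/\ compact K, nbhs x K & K `<=` A].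
Proof.
move=> cV cx oA Ax; have oU := chart_image_open c oA.
have /nbhs_closedballP[e eU] : nbhs (cmap c x) (cmap c @` (cdom c `&` A)).
  by apply: open_nbhs_nbhs; split=> //; exists x.
pose B : set V := [set v | `|v - cmap c x| <= e%:num].
have BU : B `<=` cmap c @` (cdom c `&` A).
  by move=> v Bv; apply: eU; rewrite closed_ballE // /closed_ball_ /= distrC.
exists (cinv c @` B); split.
- apply: continuous_compact; last exact: cV.
  apply: continuous_in_subspaceT => v /set_mem/BU[y [cy _] <-].
  by apply: cinv_continuous; rewrite inE; exists y.
- have oB : open (cdom c `&` cmap c @^-1` ball (cmap c x) e%:num).
    apply: open_in_preimage (cdom_open c) (@cmap_continuous _ _ _ c) _.
    exact: ball_open.
  apply: filterS (open_nbhs_nbhs (conj oB _)); last by split=> //; exact: ballxx.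
  move=> y [cy By]; exists (cmap c y); last by rewrite cmapK // inE.
  by move: By; rewrite -ball_normE /= distrC => /ltW.
- by move=> _ [v /BU[y [cy Ay] <-] <-]; rewrite cmapK // inE.
Qed.

Lemma surj_row_full (K : fieldType) m n (g : {linear 'rV[K]_m -> 'rV[K]_n}) :
  (forall w, exists v, g v = w) -> row_full (lin1_mx g).
Proof.
move=> surj; rewrite -sub1mx; apply/row_subP => i.
by have [v <-] := surj (row i 1%:M); rewrite -(mul_rV_lin1 g) submxMl.
Qed.

(** A slice transverse at v0 to the fibre of f is mapped homeomorphically onto an
    open set near v0.  All smaller radii are allowed so that one slice can serve
    for two maps f. *)
Lemma slice_in_chart (R : realType) m n (M N : topologicalType)
    (c : chart 'rV[R]_m M) (c' : chart 'rV[R]_n N) f O F v0 (L : 'M[R]_(n, m)) :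
  chart_rep c c' f O F -> O v0 -> L *m lin1_mx ('d F v0) \in unitmx ->
  exists2 d : R, 0 < d & forall d', 0 < d' -> d' <= d ->
    let S := [set cinv c (v0 + w *m L) | w in ball (0 : 'rV[R]_n) d'] in
    (forall x y, S x -> S y -> f x = f y -> x = y) /\
    (forall A, open A -> open (f @` (S `&` A))).
Proof.
move=> [oO cF Oimg cf FE] Ov uL.
have [d d0 [dO inj op]] := slice_inverse_function oO Ov cF uL.
exists d => // d' d'0 d'd S.
pose l (w : 'rV[R]_n) : 'rV[R]_m := v0 + w *m L.
have cl : continuous l by exact: affine_continuous.
have bd w : ball (0 : 'rV[R]_n) d' w -> ball (0 : 'rV[R]_n) d w.
  exact: le_ball.
split.
  move=> _ _ [w wd <-] [w' wd' <-] ww'.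
  have Ow := dO _ (bd _ wd); have Ow' := dO _ (bd _ wd').
  by rewrite (inj w w') ?FE ?ww' //; exact: bd.
move=> A oA; pose Q := ball (0 : 'rV[R]_n) d' `&` l @^-1`
  ((cmap c @` cdom c) `&` cinv c @^-1` A).
have oQ : open Q.
  apply: openI; first exact: ball_open.
  apply: open_comp; first by move=> w _; exact: cl.
  exact: open_in_preimage (cimg_open c) (@cinv_continuous _ _ _ c) oA.
have oFQ : open [set F (v0 + w *m L) | w in Q] by apply: op => // w [/bd].
suff -> : f @` (S `&` A) = cdom c' `&` cmap c' @^-1` [set F (v0 + w *m L) | w in Q].
  exact: open_in_preimage (cdom_open c') (@cmap_continuous _ _ _ c') oFQ.
apply/seteqP; split.
  move=> _ [_ [[w wd <-] Aw] <-]; have Ow := dO _ (bd _ wd).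
  split; first exact: cf.
  by exists w; [do 2!split => //; exact: Oimg|rewrite FE].
move=> y [c'y [w [wd [_ Aw]] Fw]]; have Ow := dO _ (bd _ wd).
exists (cinv c (v0 + w *m L)); first by split=> //; exists w.
by apply: (cmap_inj (c := c')); rewrite -?FE //; exact: cf.
Qed.

(** * Bisections through the arrows of a Lie groupoid *)

(** The images s(U) of the local sections s of d over open sets U such that
    r o s is an open embedding.  In this form the notion is visibly symmetric in
    d and r. *)
Definition bisection_set (G : topGroupoid) (S : set (arr G)) : Prop :=
  [/\ forall x y, S x -> S y -> gdom x = gdom y -> x = y,
      forall x y, S x -> S y -> gcod x = gcod y -> x = y,
      forall A, open A -> open (@gdom G @` (S `&` A)) &
      forall A, open A -> open (@gcod G @` (S `&` A))].

(** r = d o i, so the derivative of r at x is that of d at x^-1, which is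
    surjective, composed with that of i at x, which has the derivative of i at
    x^-1 as a right inverse. *)
Lemma gcod_surj (R : realType) n m (G : lieGroupoid R n m)
    (c : chart 'rV[R]_m (arr G)) (c1 : chart 'rV[R]_n (obj G)) (x : arr G) O F :
  arr_atlas c -> obj_atlas c1 -> cdom c x -> cdom c1 (gcod x) ->
  chart_rep c c1 (@gcod G) O F -> O (cmap c x) ->
  forall w, exists v, 'd F (cmap c x) v = w.
Proof.
move=> Ac A1 cx c1x rF Ox w.
have [ci Aci cix] := (arr_atlasP G).1 (ginv x).
have ciVx : cdom c (ginv (ginv x)) by rewrite ginvK.
have [OJ [J [rJ OJx]]] := smooth_chart_rep (@ginv_continuous G)
  (ginv_smooth G) Ac Aci cx cix.
have [OK [K [rK OKx]]] := smooth_chart_rep (@ginv_continuous G)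
  (ginv_smooth G) Aci Ac cix ciVx.
have c1dx : cdom c1 (gdom (ginv x)) by rewrite gdom_inv.
have [OD [D [rD ODx]]] := smooth_chart_rep (@gdom_continuous G)
  (gdom_smooth G) Aci A1 cix c1dx.
have [u uE] := chart_rep_surj (gdom_submersion (l := G)) Aci A1 cix c1dx rD ODx w.
exists ('d K (cmap ci (ginv x)) u).
have Jx : J (cmap c x) = cmap ci (ginv x).
  by have [_ _ _ _ JE] := rJ; rewrite JE // cmapK // inE.
have Kx : K (cmap ci (ginv x)) = cmap c x.
  by have [_ _ _ _ KE] := rK; rewrite KE // cmapK ?inE // ginvK.
have dJ := chart_rep_differentiable rJ OJx.
have dK := chart_rep_differentiable rK OKx.
have dD := chart_rep_differentiable rD ODx.
have FE : nbhs (cmap c x) (fun v => (D \o J) v = F v).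
  have rDJ := chart_rep_comp rJ rD OJx _; rewrite Jx in rDJ.
  apply: filterS2 (rDJ ODx) (chart_rep_near rF Ox) => v -> -> /=.
  by rewrite gdom_inv.
have JKE : nbhs (cmap ci (ginv x)) (fun v => (J \o K) v = v).
  have rJK := chart_rep_comp rK rJ OKx _; rewrite Kx in rJK.
  have [oOK _ OKi _ _] := rK.
  have nO : nbhs (cmap ci (ginv x)) OK by exact: open_nbhs_nbhs.
  apply: filterS2 (rJK OJx) nO => v -> /OKi[y ciy <-] /=.
  by rewrite cmapK ?inE // ginvK.
have dDJ : differentiable (D \o J) (cmap c x).
  by apply: differentiable_comp => //; rewrite Jx.
have dJK : differentiable (J \o K) (cmap ci (ginv x)).
  by apply: differentiable_comp => //; rewrite Kx.
have e1 := near_eq_diff FE dDJ.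
have e2 := near_eq_diff JKE dJK.
have e3 := @diff_comp _ _ _ _ J D (cmap c x) dJ; rewrite Jx in e3.
have e4 := @diff_comp _ _ _ _ K J (cmap ci (ginv x)) dK; rewrite Kx in e4.
set v := 'd K _ u.
transitivity ('d (D \o J) (cmap c x) v).
  exact: (congr1 (fun h : 'rV[R]_m -> 'rV[R]_n => h v) e1).
transitivity ('d D (cmap ci (ginv x)) ('d J (cmap c x) v)).
  exact: (congr1 (fun h : 'rV[R]_m -> 'rV[R]_n => h v) (e3 dD)).
rewrite -uE; congr ('d D _ _).
transitivity ('d (J \o K) (cmap ci (ginv x)) u).
  exact: (congr1 (fun h : 'rV[R]_m -> 'rV[R]_m => h u) (esym (e4 dJ))).
transitivity ('d (fun v : 'rV[R]_m => v) (cmap ci (ginv x)) u).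
  exact: (congr1 (fun h : 'rV[R]_m -> 'rV[R]_m => h u) (esym e2)).
exact: (congr1 (fun h : 'rV[R]_m -> 'rV[R]_m => h u)
  (@diff_val _ _ _ _ _ _ _ (is_diff_id _))).
Qed.

(** In a chart around x, an n-dimensional slice through x transverse to the
    fibres of both d and r. *)
Lemma lie_bisection_through (R : realType) n m (G : lieGroupoid R n m) (x : arr G) :
  exists2 S : set (arr G), bisection_set S & S x.
Proof.
have [c Ac cx] := (arr_atlasP G).1 x.
have [c0 A0 c0x] := (obj_atlasP G).1 (gdom x).
have [c1 A1 c1x] := (obj_atlasP G).1 (gcod x).
have [OD [D [rD ODx]]] := smooth_chart_rep (@gdom_continuous G)
  (gdom_smooth G) Ac A0 cx c0x.
have [OC [C [rC OCx]]] := smooth_chart_rep (@gcod_continuous G)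
  (gcod_smooth G) Ac A1 cx c1x.
have [L [LD LC]] := common_section
  (surj_row_full (chart_rep_surj (gdom_submersion (l := G)) Ac A0 cx c0x rD ODx))
  (surj_row_full (gcod_surj Ac A1 cx c1x rC OCx)).
have [d1 d10 h1] := slice_in_chart rD ODx LD.
have [d2 d20 h2] := slice_in_chart rC OCx LC.
have d0 : 0 < Num.min d1 d2 by rewrite lt_min d10.
have [|inj1 op1] := h1 _ d0; first by rewrite ge_min lexx.
have [|inj2 op2] := h2 _ d0; first by rewrite ge_min lexx orbT.
eexists; first by split; [exact: inj1|exact: inj2|exact: op1|exact: op2].
exists 0; first exact: ballxx.
by rewrite mul0mx addr0 cmapK // inE.
Qed.

(** * Bisections of the quantale as sets of arrows *)

Local Close Scope ring_scope.
Local Open Scope locale_scope.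

Section bisection_sets.
Variables (G : topGroupoid) (G_open : open_groupoid G).
Hypothesis obj_T2 : hausdorff_space (obj G).
Hypothesis arr_T2 : hausdorff_space (arr G).

Let Q : qframe := groupoid_quantale G_open.
Implicit Types (a b : Q) (z w : RQ Q) (σ τ ρ : bisection Q) (x y : arr G).

Lemma opens_topE (T : topologicalType) : sval (stop : opens T) = setT.
Proof.
apply/seteqP; split=> // t _.
exact: (@sle_top (opens T) (exist open setT openT) t I).
Qed.

Lemma saturated z x y : gdom x = gdom y -> sval (sval z) x -> sval (sval z) y.
Proof.
move=> xy zx; apply: (svalP z); exists x, (gmul (ginv x) y).
rewrite gdom_mul ?gcod_inv ?gdom_inv //; split=> //; last by rewrite gmulKV.
by rewrite opens_topE.
Qed.

Lemma open_dom_preimage (P : set (obj G)) : open P -> open (@gdom G @^-1` P).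
Proof. by apply: open_comp => x _; exact: gdom_continuous. Qed.

Lemma dom_preimage_right_sided (P : set (obj G)) (oP : open P) :
  let a : Q := exist open _ (open_dom_preimage oP) in a ⋅ stop ⊑ a.
Proof. by move=> a _ [x [y [Px _ xy ->]]]; rewrite /a /= gdom_mul. Qed.

Definition dom_preimage (P : set (obj G)) (oP : open P) : RQ Q :=
  exist (fun a : Q => a ⋅ stop ⊑ a) _ (@dom_preimage_right_sided P oP).

(** The range of the section that corresponds to sigma: when the space of arrows
    is Hausdorff, x is the value of the section at d x as soon as every
    neighbourhood a of x has d x in its inverse image. *)
Definition graph σ : set (arr G) :=
  [set x | forall a, sval a x -> sval (sval (bim σ a)) x].

Lemma bim_mono σ a b : a ⊑ b -> bim σ a ⊑ bim σ b.
Proof. exact: (@invim_mono _ _ (bsec σ)). Qed.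

Lemma bim_RQ σ z : bim σ (sval z) = z ⊓ bdom σ.
Proof. by have /(congr1 sval) := bsec_dom σ z. Qed.

(** The open sets b with x in s^*(b) form a completely prime filter.  So the union
    N of the open sets that do not belong to it does not belong to it either;
    any point of a outside N is on the graph. *)
Lemma graph_through σ a x : sval (sval (bim σ a)) x ->
  exists y, [/\ graph σ y, sval a y & gdom y = gdom x].
Proof.
move=> ax; pose F b := sval (sval (bim σ b)) x.
pose N : Q := ⋁ [set b | ~ F b].
have nFN : ~ F N.
  by rewrite /F /N bim_sup => -[_ [_ [b nFb <-] <-]]; exact: nFb.
have [y ay nNy] : exists2 y, sval a y & ~ sval N y.
  apply: contrapT => ne; apply: nFN; apply: bim_mono ax => y ay.
  by apply: contrapT => nNy; apply: ne; exists y.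
have Fy b : sval b y -> F b.
  by move=> yb; apply: contrapT => nFb; apply: nNy; exists b.
have yx : gdom y = gdom x.
  apply: contrapT => /eqP; rewrite eq_sym => /eqP yx.
  have := hausdorff_accessible obj_T2; move/accessible_closed_set1.
  move=> /(_ (gdom x))/closed_openC oU.
  have /Fy : sval (sval (dom_preimage oU)) y by exact/nesym.
  by rewrite /F bim_RQ => /(@smeetl (RQ Q) (dom_preimage oU) (bdom σ)); exact.
exists y; split=> // b yb; apply: saturated (Fy _ yb).
by [].
Qed.

Lemma bimE σ a x : sval (sval (bim σ a)) x <->
  exists y, [/\ graph σ y, sval a y & gdom y = gdom x].
Proof.
split=> [|[y [σy ay yx]]]; first exact: graph_through.
exact: saturated yx (σy _ ay).
Qed.

Lemma bim_meet_pts σ a b x : sval (sval (bim σ a)) x -> sval (sval (bim σ b)) x ->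
  exists y, sval a y /\ sval b y.
Proof.
move=> ax bx; have : sval (sval (bim σ (a ⊓ b))) x.
  by rewrite bim_meet RQ_meetE opens_meetE.
by move=> /bimE[y [_ + _]]; rewrite opens_meetE; exists y.
Qed.

Lemma graph_dom_inj σ x y : graph σ x -> graph σ y -> gdom x = gdom y -> x = y.
Proof.
move=> σx σy xy; apply: arr_T2 => A B.
rewrite !nbhsE => -[A' [oA' A'x] A'A] [B' [oB' B'y] B'B].
pose a : Q := exist open A' oA'; pose b : Q := exist open B' oB'.
have xb : sval (sval (bim σ b)) x := saturated (esym xy) (σy b B'y).
have [t [/= At Bt]] := bim_meet_pts (σx a A'x) xb.
by exists t; split; [exact: A'A|exact: B'B].
Qed.

(** As r o s is a regular monomorphism, every open subset V of its domain is the
    inverse image of an open set w; take for V the objects other than d y. *)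
Lemma graph_cod_inj σ x y : graph σ x -> graph σ y -> gcod x = gcod y -> x = y.
Proof.
move=> σx σy xy; apply: (graph_dom_inj σx σy); apply: contrapT => dxy.
have := hausdorff_accessible obj_T2; move/accessible_closed_set1.
move=> /(_ (gdom y))/closed_openC oU.
pose V := dom_preimage oU ⊓ bdom σ.
have VU : V ⊑ bdom σ by exact: smeetr.
have Vx : sval (sval V) x.
  rewrite RQ_meetE opens_meetE; split; first exact: dxy.
  by rewrite -bim_top; apply: σx; rewrite opens_topE.
have [w wE] := (lm_regular_monoP _).1 (bsec_mono σ)
  (exist (fun z => z ⊑ bdom σ) V VU).
move/(congr1 sval): wE => /= wE.
have /bimE[x' [σx' + xx']] : sval (sval (bim σ (sval w)^i)) x by rewrite /bim wE.
rewrite (graph_dom_inj σx' σx xx') => -[t wt tx].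
have wy : sval (sval w)^i y.
  exists (ginv y); last exact: ginvK.
  by apply: (saturated _ wt); rewrite gdom_inv -xy -tx gcod_inv.
have := σy _ wy; rewrite /bim wE => /(@smeetl (RQ Q) (dom_preimage oU) (bdom σ)).
exact.
Qed.

(** For the image under r, openness of r o s gives a direct image of s^*(A); it
    contains no object q outside the pointwise image, being the least open set
    whose inverse image contains s^*(A), hence contained in the complement of
    q. *)
Lemma graph_bisection σ : bisection_set (graph σ).
Proof.
split; [exact: graph_dom_inj|exact: graph_cod_inj|move=> A oA|move=> A oA].
- have -> : @gdom G @` (graph σ `&` A) =
      @gdom G @` sval (sval (bim σ (exist open A oA))).
    apply/seteqP; split=> [_ [x [σx Ax] <-]|_ [x /bimE[y [σy Ay yx]] <-]].
      by exists x => //; exact: σx.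
    by exists y.
  by apply: G_open; exact: (svalP (sval (bim σ (exist open A oA)))).
- have [dir [adj _]] := bsec_open σ.
  pose a : Q := exist open A oA; pose V : seg (bdom σ) := (bsec σ)^★ a.
  have -> : @gcod G @` (graph σ `&` A) = @gdom G @` sval (sval (dir V)).
    have le_dir : V ⊑ (rQ Q ∘l bsec σ)^★ (dir V) by apply/adj; exact: sle_refl.
    apply/seteqP; split=> [_ [x [σx Ax] <-]|_ [x dirx <-]].
      have /le_dir : sval (sval (sval V)) x by apply: (σx a).
      move=> /bimE[y [σy + yx]]; rewrite (graph_dom_inj σy σx yx) => -[t dt tx].
      by exists t => //; rewrite -tx gcod_inv.
    apply: contrapT => nx.
    have := hausdorff_accessible obj_T2; move/accessible_closed_set1.
    move=> /(_ (gdom x))/closed_openC oU.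
    suff /adj/(_ x dirx) : V ⊑ (rQ Q ∘l bsec σ)^★ (dom_preimage oU) by exact.
    move=> t /bimE[y [σy Ay yt]].
    apply/bimE; exists y; split=> //; exists (ginv y); last exact: ginvK.
    by rewrite /= gdom_inv => yx; apply: nx; exists y.
  by apply: G_open; exact: (svalP (sval (dir V))).
Qed.

Lemma RQ_ext z w : (forall x, sval (sval z) x <-> sval (sval w) x) -> z = w.
Proof.
by move=> zw; apply: sig_inj; apply: sig_inj; apply/seteqP; split=> x /zw.
Qed.

Lemma graph_eq ρ (S : set (arr G)) :
  (forall x y, S x -> S y -> gdom x = gdom y -> x = y) ->
  (forall a x, sval (sval (bim ρ a)) x <->
     exists y, [/\ S y, sval a y & gdom y = gdom x]) ->
  graph ρ = S.
Proof.
move=> inj bimS; apply/seteqP; split=> x; last first.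
  by move=> Sx a ax; apply/bimS; exists x.
move=> gx; have [|y [Sy _ yx]] := (bimS stop x).1 _.
  by apply: gx; rewrite opens_topE.
suff -> : x = y by [].
apply: arr_T2 => A B; rewrite !nbhsE => -[A' [oA' A'x] A'A] [B' [oB' B'y] B'B].
pose a : Q := exist open A' oA'.
have [y' [Sy' /= Ay' y'x]] := (bimS a x).1 (gx a A'x).
exists y; split; last exact: B'B.
by apply: A'A; rewrite (inj y y') // yx.
Qed.

#[local] Obligation Tactic := idtac.

Section of_set.
Variables (S : set (arr G)) (hS : bisection_set S).

Let img_open a : open (@gdom G @` (S `&` sval a)).
Proof. by case: hS => _ _ h _; apply: h; exact: (svalP a). Qed.

(** s^*(a), where s is the section of d with range S. *)
Definition set_bim a : RQ Q := dom_preimage (@img_open a).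

Let img_le a : set_bim a ⊑ set_bim stop.
Proof.
by move=> x [y [Sy _] yx]; exists y => //; split=> //; rewrite opens_topE.
Qed.

Program Definition set_sec : locmap (seg (set_bim stop)) Q :=
  @LocMap (seg (set_bim stop)) Q
    (fun a => exist (fun z => z ⊑ set_bim stop) (set_bim a) (@img_le a)) _ _ _.
Next Obligation.
move=> F; apply: sig_inj; apply: RQ_ext => x; split.
- move=> [y [Sy [a Fa ay]] yx].
  exists (sval (set_bim a)); last by exists y.
  exists (set_bim a) => //.
  by exists (exist (fun z => z ⊑ set_bim stop) _ (@img_le a)) => //; exists a.
- move=> [_ [_ [_ [a Fa <-] <-] <-] [y [Sy ay] yx]].
  by exists y => //; split=> //; exists a.
Qed.
Next Obligation.
move=> a b; apply: sig_inj; rewrite seg_meetE; apply: RQ_ext => x.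
rewrite RQ_meetE opens_meetE; split.
- move=> [y [Sy]]; rewrite opens_meetE => -[ay By] yx.
  by split; exists y.
- move=> [[y [Sy ay] yx] [y' [Sy' by'] y'x]].
  have yy' : y = y' by case: hS => inj _ _ _; apply: inj => //; rewrite yx.
  by exists y => //; split=> //; rewrite opens_meetE yy'; split=> //; rewrite -yy'.
Qed.
Next Obligation. by apply: sig_inj; rewrite seg_topE. Qed.

Lemma set_sec_dom : lm_eq (dQ Q ∘l set_sec) (k_ (set_bim stop)).
Proof.
move=> z; apply: sig_inj; rewrite -[RHS]/(z ⊓ set_bim stop).
apply: RQ_ext => x; rewrite RQ_meetE opens_meetE.
split=> [[y [Sy zy] yx]|[zx [y [Sy _] yx]]].
- split; first exact: saturated yx zy.
  by exists y => //; split=> //; rewrite opens_topE.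
- by exists y => //; split=> //; apply: saturated zx.
Qed.

(** The direct image of V is the image under r of the part of S over V. *)
Lemma set_sec_open : lm_open (rQ Q ∘l set_sec).
Proof.
have cod_open (a : Q) : open (@gcod G @` (S `&` sval a)).
  by case: hS => _ _ _; apply; exact: (svalP a).
exists (fun V => dom_preimage (cod_open (sval (sval V)))).
have adj (V : seg (set_bim stop)) z :
    dom_preimage (cod_open (sval (sval V))) ⊑ z <-> V ⊑ (rQ Q ∘l set_sec)^★ z.
  rewrite -[V ⊑ _]/(forall x, sval (sval (sval V)) x -> _).
  rewrite -[_ ⊑ z]/(forall x, _ -> sval (sval z) x).
  split=> [h x Vx|h x [y [Sy Vy] yx]].
  - have [y [Sy _] yx] := svalP V x Vx.
    exists y => //; split=> //; exists (ginv y); last exact: ginvK.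
    apply: h; exists y; rewrite ?gdom_inv //; split=> //.
    exact: saturated (esym yx) Vx.
  - have [y' [Sy' [t zt ty']] y'y] := h y Vy.
    have yy' : y' = y by case: hS => inj _ _ _; exact: inj.
    by apply: (saturated _ zt); rewrite -yx -yy' -ty' gcod_inv.
split=> // V z; apply: RQ_ext => x.
have mE y : sval (sval (sval (V ⊓ (rQ Q ∘l set_sec)^★ z))) y <->
    sval (sval (sval V)) y /\ sval (sval (sval ((rQ Q ∘l set_sec)^★ z))) y.
  have -> := congr1 (fun u : RQ Q => sval (sval u) y)
    (seg_meetE V ((rQ Q ∘l set_sec)^★ z)).
  by rewrite RQ_meetE opens_meetE.
rewrite RQ_meetE opens_meetE; split.
- move=> [y [Sy /mE[Vy [y' [Sy' [t zt ty']] y'y]]] yx].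
  have yy' : y' = y by case: hS => inj _ _ _; exact: inj.
  split; first by exists y.
  by apply: (saturated _ zt); rewrite -yx -yy' -ty' gcod_inv.
- move=> [[y [Sy Vy] yx] zx]; exists y => //; split=> //; apply/mE; split=> //.
  exists y => //; split=> //; exists (ginv y); last exact: ginvK.
  by apply: (saturated _ zx); rewrite gdom_inv.
Qed.

(** By injectivity of r on S, a set V of objects is recovered from the image under
    r of the part of S over V. *)
Lemma set_sec_mono : lm_regular_mono (rQ Q ∘l set_sec).
Proof.
have cod_open (a : Q) : open (@gcod G @` (S `&` sval a)).
  by case: hS => _ _ _; apply; exact: (svalP a).
apply/lm_regular_monoP => V; exists (dom_preimage (cod_open (sval (sval V)))).
apply: sig_inj; apply: RQ_ext => x /=; split.
- move=> [y [Sy [t [y' [Sy' Vy'] y't] ty]] yx].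
  have yy' : y' = y.
    by case: hS => _ inj _ _; apply: inj => //; rewrite y't -ty gcod_inv.
  by apply: saturated yx _; rewrite -yy'.
- move=> Vx; have [y [Sy _] yx] := svalP V x Vx.
  exists y => //; split=> //; exists (ginv y); last exact: ginvK.
  exists y; rewrite ?gdom_inv //; split=> //.
  exact: saturated (esym yx) Vx.
Qed.

Definition set_bisection : bisection Q :=
  Bisection set_sec_dom set_sec_open set_sec_mono.

Lemma graph_set_bisection : graph set_bisection = S.
Proof.
apply: graph_eq => [|a x]; first by case: hS.
by split=> [[y [Sy ay] yx]|[y [Sy ay yx]]]; exists y.
Qed.

End of_set.

(** * Products, joins and actions on graphs *)

Lemma gmul_box x y (A : set (arr G)) :
  open A -> gcod x = gdom y -> A (gmul x y) ->
  exists a b, [/\ sval a x, sval b y & sval (a ⋅ b) `<=` A].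
Proof.
move=> oA xy Axy.
have : \forall p \near ((x, y) : arr G * arr G),
    gcod p.1 = gdom p.2 -> A (gmul p.1 p.2).
  have /subspace_continuousP/(_ (x, y) xy) h := @gmul_continuous G.
  by apply: (h A); exact: open_nbhs_nbhs.
case=> -[C D] [/= Cx Dy] CD.
rewrite !nbhsE in Cx Dy; have [C' [oC' C'x] C'C] := Cx.
have [D' [oD' D'y] D'D] := Dy.
exists (exist open C' oC'), (exist open D' oD'); split=> //.
move=> _ [u [v [/= C'u D'v uv ->]]].
by apply: (CD (u, v)) => //=; split; [exact: C'C|exact: D'D].
Qed.

Lemma gmul_graph_dom_inj σ τ x y :
  set_gmul (graph σ) (graph τ) x -> set_gmul (graph σ) (graph τ) y ->
  gdom x = gdom y -> x = y.
Proof.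
move=> [x1 [x2 [σx1 τx2 x12 ->]]] [y1 [y2 [σy1 τy2 y12 ->]]].
rewrite !gdom_mul // => /(graph_dom_inj σx1 σy1) xy; rewrite xy in x12 *.
by rewrite (graph_dom_inj τx2 τy2) // -x12.
Qed.

Lemma mul_through σ τ a x :
  sval (sval (⋁ [set w | exists b c, b ⋅ c ⊑ a /\
    w = bim σ (b ⊓ (sval (bim τ c))^i)])) x <->
  exists y, [/\ set_gmul (graph σ) (graph τ) y, sval a y & gdom y = gdom x].
Proof.
split.
- move=> [_ [_ [b [c [bca ->]]] <-] /bimE[y [σy + yx]]].
  rewrite opens_meetE => -[bby [t /bimE[u [τu cu ut]] ty]].
  have yu : gcod y = gdom u by rewrite -ty gcod_inv.
  exists (gmul y u); rewrite gdom_mul //; split=> //; first by exists y, u.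
  by apply: bca; exists y, u.
- move=> [_ [[y [u [σy τu yu ->]]] + ]]; rewrite gdom_mul // => ayu yx.
  have [b [c [bby cu bca]]] := gmul_box (svalP a) yu ayu.
  exists (sval (bim σ (b ⊓ (sval (bim τ c))^i))).
    by exists (bim σ (b ⊓ (sval (bim τ c))^i)) => //; exists b, c.
  apply/bimE; exists y; split=> //; rewrite opens_meetE; split=> //.
  exists (ginv y); last exact: ginvK.
  by apply/bimE; exists u; split=> //; rewrite gdom_inv.
Qed.

(** The formula for the product is the inverse image along the pointwise product of
    two sections, because multiplication is continuous on composable pairs. *)
Lemma is_mulP σ τ ρ :
  is_mul σ τ ρ <-> graph ρ = set_gmul (graph σ) (graph τ).
Proof.
split=> [[_ ρE]|ρE].
  apply: graph_eq => [|a x]; first exact: gmul_graph_dom_inj.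
  by rewrite ρE; exact: mul_through.
split=> [|a].
- apply: RQ_ext => x; rewrite -[bdom ρ]bim_top -[bdom τ]bim_top; split.
  + move=> /bimE[y []]; rewrite ρE => -[u [v [σu τv uv ->]]] _.
    rewrite gdom_mul // => ux; apply/bimE; exists u; split=> //.
    exists (ginv u); last exact: ginvK.
    by apply/bimE; exists v; rewrite gdom_inv opens_topE.
  + move=> /bimE[u [σu [t /bimE[v [τv _ vt]] tu] ux]].
    have uv : gcod u = gdom v by rewrite -tu gcod_inv.
    apply/bimE; exists (gmul u v); rewrite gdom_mul // opens_topE ρE; split=> //.
    by exists u, v.
- apply: RQ_ext => x; split.
    by move=> /bimE; rewrite ρE; move/mul_through.
  by move/mul_through; rewrite -ρE => /bimE.
Qed.

Lemma bactE σ a x : sval (bact σ a) x <->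
  exists y, [/\ graph σ y, gdom y = gdom x & sval a (gmul (ginv y) x)].
Proof.
split.
- move=> [_ [b [c [bca ->]]]]; rewrite opens_meetE => -[/bimE[y [σy bby yx]] cx].
  exists y; split=> //; apply: bca; exists (ginv y), x; split=> //.
  + by exists y.
  + by rewrite gcod_inv.
- move=> [y [σy yx ayx]].
  have [|b [c [bby cx bca]]] := gmul_box (svalP a) _ ayx; first by rewrite gcod_inv.
  exists (sval (bim σ b^i) ⊓ c).
    by exists b^i, c; split=> //; rewrite qinvK.
  rewrite opens_meetE; split=> //; apply/bimE; exists y; split=> //.
  by exists (ginv y); rewrite ?ginvK.
Qed.

Lemma jQE a σ : sval (jQ a) σ <-> graph σ `<=` sval a.
Proof.
rewrite /= -bim_top; split=> [aE x σx|σa].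
  have /bimE[y [σy ay yx]] : sval (sval (bim σ a)) x.
    by rewrite aE; apply: σx; rewrite opens_topE.
  by rewrite -(graph_dom_inj σy σx yx).
apply: RQ_ext => x; split=> /bimE[y [σy _ yx]]; apply/bimE; exists y; split=> //.
- by rewrite opens_topE.
- exact: σa.
Qed.

Lemma ble_graph σ τ : ble σ τ -> graph σ `<=` graph τ.
Proof.
by move=> [_ bE] x σx a /σx; rewrite bE RQ_meetE opens_meetE => -[].
Qed.

Lemma graph_restr σ z (zU : z ⊑ bdom σ) :
  graph (restr zU) = graph σ `&` sval (sval z).
Proof.
have rE a : bim (restr zU) a = bim σ a ⊓ z by [].
apply/seteqP; split=> x.
- move=> rx; split; first by move=> a /rx; rewrite rE RQ_meetE opens_meetE => -[].
  have : sval (sval (bim (restr zU) stop)) x by apply: rx; rewrite opens_topE.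
  by rewrite rE RQ_meetE opens_meetE => -[].
- by move=> [σx zx] a /σx ax; rewrite rE RQ_meetE opens_meetE.
Qed.

(** Restricting rho to the union of the domains of the members of B yields another
    upper bound of B. *)
Lemma join_graph (B : set (bisection Q)) ρ x :
  is_join B ρ -> graph ρ x -> exists2 σ, B σ & graph σ x.
Proof.
move=> [ub lub] ρx; pose e : RQ Q := ⋁ (@bdom Q @` B).
have eρ : e ⊑ bdom ρ by apply: ssup_le => _ [σ Bσ <-]; case: (ub _ Bσ).
have [ρe _] : ble ρ (restr eρ).
  apply: lub => σ Bσ; apply: ble_restr; first exact: ub.
  by apply: ssup_ub; exists σ.
have : sval (sval (bim ρ stop)) x by apply: ρx; rewrite opens_topE.
rewrite bim_top => /ρe[_ [_ [σ Bσ <-] <-]]; rewrite -bim_top => /bimE[y [σy _ yx]].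
by exists σ => //; rewrite -(graph_dom_inj (ble_graph (ub _ Bσ) σy) ρx yx).
Qed.

(** * Weak embeddability *)

Lemma bisection_set_mul (S T : set (arr G)) :
  bisection_set S -> bisection_set T -> bisection_set (set_gmul S T).
Proof.
move=> [dS cS odS ocS] [dT cT odT ocT]; split.
- move=> _ _ [x [y [Sx Ty xy ->]]] [x' [y' [Sx' Ty' xy' ->]]].
  rewrite !gdom_mul // => /(dS _ _ Sx Sx') e; rewrite e in xy *.
  by rewrite (dT y y') // -xy.
- move=> _ _ [x [y [Sx Ty xy ->]]] [x' [y' [Sx' Ty' xy' ->]]].
  rewrite !gcod_mul // => /(cT _ _ Ty Ty') e; rewrite e in xy *.
  by rewrite (cS x x') // xy.
- move=> A oA; rewrite openE => _ [_ [[x [y [Sx Ty xy ->]]] Axy] <-].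
  have [b [c [bx cy bcA]]] := gmul_box oA xy Axy.
  have oU : open (sval b `&` @gcod G @^-1` (@gdom G @` (T `&` sval c))).
    apply: openI; first exact: (svalP b).
    apply: open_comp; first by move=> u _; exact: gcod_continuous.
    by apply: odT; exact: (svalP c).
  apply: filterS (open_nbhs_nbhs (conj (odS _ oU) _)).
    move=> _ [u [Su [bu [v [Tv cv] uv]]] <-].
    exists (gmul u v); last exact: gdom_mul.
    by split; [exists u, v|apply: bcA; exists u, v].
  by rewrite gdom_mul //; exists x => //; do 2!split=> //; exists y.
- move=> A oA; rewrite openE => _ [_ [[x [y [Sx Ty xy ->]]] Axy] <-].
  have [b [c [bx cy bcA]]] := gmul_box oA xy Axy.
  have oU : open (sval c `&` @gdom G @^-1` (@gcod G @` (S `&` sval b))).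
    apply: openI; first exact: (svalP c).
    apply: open_comp; first by move=> u _; exact: gdom_continuous.
    by apply: ocS; exact: (svalP b).
  apply: filterS (open_nbhs_nbhs (conj (ocT _ oU) _)).
    move=> _ [v [Tv [cv [u [Su bu] uv]]] <-].
    exists (gmul u v); last exact: gcod_mul.
    by split; [exists u, v|apply: bcA; exists u, v].
  by rewrite gcod_mul //; exists y => //; do 2!split=> //; exists x.
Qed.

Lemma bisection_set_inv (S : set (arr G)) :
  bisection_set S -> bisection_set (@ginv G @` S).
Proof.
move=> [dS cS odS ocS].
have op A : open A -> open (@ginv G @^-1` A).
  by apply: open_comp => u _; exact: ginv_continuous.
split.
- move=> _ _ [x Sx <-] [y Sy <-]; rewrite !gdom_inv => /(cS _ _ Sx Sy).
  by move=> ->.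
- move=> _ _ [x Sx <-] [y Sy <-]; rewrite !gcod_inv => /(dS _ _ Sx Sy).
  by move=> ->.
- move=> A oA; rewrite (_ : _ @` _ = @gcod G @` (S `&` @ginv G @^-1` A)).
    by apply: ocS; exact: op.
  apply/seteqP; split=> [_ [_ [[x Sx <-] Ax] <-]|_ [x [Sx Ax] <-]].
    by exists x; rewrite ?gdom_inv.
  by exists (ginv x); [split=> //; exists x|rewrite gdom_inv].
- move=> A oA; rewrite (_ : _ @` _ = @gdom G @` (S `&` @ginv G @^-1` A)).
    by apply: odS; exact: op.
  apply/seteqP; split=> [_ [_ [[x Sx <-] Ax] <-]|_ [x [Sx Ax] <-]].
    by exists x; rewrite ?gcod_inv.
  by exists (ginv x); [split=> //; exists x|rewrite gcod_inv].
Qed.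

Lemma groupoid_weakly_embeddable : weakly_embeddable Q.
Proof.
move=> σ a; apply: sle_anti.
  apply: clset_min => ρ [τ [π [τσ /jQE πa /is_mulP ρE]]]; apply/jQE.
  rewrite ρE => _ [y [u [τy πu yu ->]]]; apply/bactE; exists y.
  rewrite gdom_mul // gmulVK //; split=> //; last exact: πa.
  exact: ble_graph τσ _ τy.
move=> ρ /jQE ρa; apply: sub_clset.
(* rho = sigma (sigma^-1 rho), and the graph of sigma^-1 rho lies in a. *)
have hT := bisection_set_mul (bisection_set_inv (graph_bisection σ))
  (graph_bisection ρ).
exists σ, (set_bisection hT); split; first exact: ble_refl.
- apply/jQE; rewrite graph_set_bisection => _ [_ [w [[y σy <-] ρw yw ->]]].
  have /bactE[y' [σy' y'w]] := ρa _ ρw.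
  by rewrite (graph_dom_inj σy' σy) // y'w -yw gcod_inv.
- apply/is_mulP; rewrite graph_set_bisection; apply/seteqP; split=> w.
    move=> ρw; have /bactE[y [σy yw _]] := ρa _ ρw.
    exists y, (gmul (ginv y) w); rewrite gmulKV ?gdom_mul ?gcod_inv ?gdom_inv //.
    split=> //; by exists (ginv y), w; rewrite gcod_inv.
  move=> [y [_ [σy [_ [v [[y' σy' <-] ρv y'v ->]]] + ->]]].
  rewrite gdom_mul // gdom_inv => yy'.
  by rewrite (graph_cod_inj σy σy' yy') gmulKV // -y'v gcod_inv.
Qed.

(** * Spatiality of the tensor product *)

Section spatiality.
Hypothesis arr_locally_compact : forall x (A : set (arr G)), open A -> A x ->
  exists K : set (arr G), [/\ compact K, nbhs x K & K `<=` A].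

Variable X : tensor (@Q_ract Q) (@Q_lact Q).

(** Let U and V be disjoint neighbourhoods of r x and d y.  By the balance
    relation r^-1(U) (x) d^-1(V) is the tensor of 1 with the meet of d^-1(U) and
    d^-1(V), which is 0. *)
Lemma tensor_noncomposable x y : gcod x <> gdom y ->
  exists a b, [/\ sval X (a, b), sval a x & sval b y].
Proof.
move=> xy; have [U [V [oU oV Ux Vy UV]]] : exists U V : set (obj G),
    [/\ open U, open V, U (gcod x), V (gdom y) & forall p, U p -> ~ V p].
  apply: contrapT => nUV; apply: xy; apply: obj_T2 => A B.
  rewrite !nbhsE => -[A' [oA' A'x] A'A] [B' [oB' B'y] B'B].
  apply: contrapT => nAB; apply: nUV; exists A', B'; split=> // p A'p B'p.
  by apply: nAB; exists p; split; [exact: A'A|exact: B'B].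
have [down _ supr bal] := svalP X.
exists (Q_ract stop (dom_preimage oU)), (sval (dom_preimage oV)); split=> //.
- apply/bal; apply: (down _ _ _ _) (supr stop set0 _) => //.
  move=> t; rewrite /Q_lact opens_meetE => -[Vt Ut]; case: (UV _ Ut Vt).
- rewrite /Q_ract opens_meetE opens_topE; split=> //.
  by exists (ginv x); rewrite ?ginvK //= gdom_inv.
Qed.

(** The classical argument for products with a locally compact factor: a is the
    union of open sets a' contained in a compact subset K of a, and for y in b
    finitely many boxes of X that contain y in their second factor cover K, so
    that a' times the intersection of their second factors is in X. *)
Lemma tensor_spatial a b :
  (forall x y, sval a x -> sval b y -> gcod x = gdom y ->
     exists a' b', [/\ sval X (a', b'), sval a' x & sval b' y]) ->
  sval X (a, b).
Proof.
move=> Xab; have [down supl supr _] := svalP X.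
have box x y : sval a x -> sval b y ->
    exists a' b', [/\ sval X (a', b'), sval a' x & sval b' y].
  move=> ax bY; have [xy|] := pselect (gcod x = gdom y); first exact: Xab.
  exact: tensor_noncomposable.
pose inner : set Q := [set a' |
  exists2 K, compact K & sval a' `<=` K /\ K `<=` sval a].
have a_le : a ⊑ ⋁ inner.
  move=> x ax; have [K [cK Kx Ka]] := arr_locally_compact (svalP a) ax.
  have oK : open K° by exact: open_interior.
  exists (exist open _ oK); last exact: Kx.
  by exists K => //; split=> //; exact: interior_subset.
apply: (down _ _ _ _) a_le (sle_refl b) _; apply: (supl _ _) => a' [K cK [a'K Ka]].
pose S : set Q := [set b' | sval X (a', b')].
have b_le : b ⊑ ⋁ S.
  move=> y bY.
  (* The boxes of X around y are directed under enlarging their first factor, and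
     F is the filter of their tails; compactness of K along F replaces the choice
     of finitely many boxes. *)
  pose D : set (Q * Q) := [set t | sval X t /\ sval t.2 y].
  pose F : set_system (Q * Q) := [set E |
    exists2 t0, D t0 & forall t, D t -> t0.1 ⊑ t.1 -> E t].
  have F_filter : Filter F.
    split.
    - exists (⋁ set0, stop) => //; split; last by rewrite opens_topE.
      exact: (supl _ _).
    - move=> E E' [[A B] [/= XAB By] EP] [[A' B'] [/= XAB' By'] EP'].
      exists (⋁ [set u | u = A \/ u = A'], B ⊓ B').
        split; last by rewrite opens_meetE.
        apply: (supl _ _) => u [->|->].
          exact: (down _ _ _ _) (sle_refl _) (smeetl _ _) XAB.
        exact: (down _ _ _ _) (sle_refl _) (smeetr _ _) XAB'.
      move=> t Dt le_t; split; [apply: EP|apply: EP'] => //.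
        by apply: sle_trans le_t; apply: ssup_ub; left.
      by apply: sle_trans le_t; apply: ssup_ub; right.
    - by move=> E E' EE' [t0 Dt0 EP]; exists t0 => // t Dt /(EP _ Dt)/EE'.
  have /compact_near_coveringP/(_ _ F (fun t x => sval t.1 x) F_filter) := cK.
  case=> [x Kx|[A B] [/= XAB By] KP].
    have [A [B [XAB Ax By]]] := box x y (Ka _ Kx) bY.
    exists (sval A, [set t | A ⊑ t.1]) => /=; last first.
      by move=> [u t] /= [Au At]; exact: At.
    split; first by apply: open_nbhs_nbhs; split=> //; exact: (svalP A).
    by exists (A, B).
  have a'A : a' ⊑ A by move=> x /a'K; exact: (KP (A, B)).
  by exists B => //; exact: down a'A (sle_refl _) XAB.
by apply: (down _ _ _ _) (sle_refl _) b_le _; apply: supr.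
Qed.

End spatiality.

(** * Separation of the tensor product by bisections *)

Lemma hat_meetE (A B : hat Q) : sval (A ⊓ B) = sval A `&` sval B.
Proof.
apply/seteqP; split=> [σ ABσ|].
  by split; [exact: (@smeetl (hat Q) A B)|exact: (@smeetr (hat Q) A B)].
have cAB : compatibly_closed (sval A `&` sval B).
  have [[dA jA] [dB jB]] := (svalP A, svalP B).
  split=> [ρ τ [Aρ Bρ] τρ|F ρ FAB Fc Fρ].
    by split; [exact: dA τρ|exact: dB τρ].
  by split; [apply: jA Fρ|apply: jB Fρ] => // τ /FAB[].
by apply: (@smeet_glb (hat Q) A B (exist _ _ cAB)) => σ [].
Qed.

Section separation.
Variable Y : tensor (@Q_ract Q) (@Q_lact Q).

Definition covered (x y : arr G) : Prop :=
  exists a b, [/\ sval Y (a, b), sval a x & sval b y].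

Lemma covered_left_closed b : compatibly_closed
  [set σ | forall x y, graph σ x -> sval b y -> gcod x = gdom y -> covered x y].
Proof.
split=> [σ τ /= σb τσ x y /(ble_graph τσ)|B ρ Bb _ Bρ x y ρx].
  exact: σb.
by have [σ /Bb σb σx] := join_graph Bρ ρx; exact: σb.
Qed.

(** The relations of the tensor product hold because restricting the bisections in
    A to r^-1(z) amounts to keeping the composable pairs (x, y) with y in z. *)
Lemma covered_closed : tensor_closed (@hat_ract Q) (@Q_lact Q)
  [set t | forall σ x y, sval t.1 σ -> graph σ x -> sval t.2 y ->
     gcod x = gdom y -> covered x y].
Proof.
split.
- move=> A A' b b' AA' bb' h σ x y Aσ σx bY.
  by apply: h (AA' _ Aσ) σx (bb' _ bY).
- move=> F b Fb σ x y Fσ; move: x y.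
  pose C : hat Q := exist _ _ (covered_left_closed b).
  suff /(_ σ Fσ) : ⋁ F ⊑ C by [].
  by apply: ssup_le => A FA τ Aτ x y; exact: Fb FA τ x y Aτ.
- by move=> A F FA σ x y Aσ σx [b Fb bY]; exact: FA Fb σ x y Aσ σx bY.
- move=> A z b; split=> h σ x y.
  + move=> Aσ σx; rewrite /Q_lact opens_meetE => -[bY zy] xy.
    have zx : sval (sval z)^i x.
      exists (ginv x); last exact: ginvK.
      by apply: saturated zy; rewrite gdom_inv.
    pose σz := restr (bim_le σ (sval z)^i).
    apply: (h σz x y) => //; last first.
      by rewrite graph_restr; split=> //; exact: σx.
    rewrite /hat_ract hat_meetE; split.
      by have [dA _] := svalP A; apply: dA Aσ _; split; first exact: bim_le.
    apply/jQE; rewrite graph_restr => t [σt /bimE[t' [σt' zt' tt']]].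
    by rewrite -(graph_dom_inj σt' σt tt').
  + rewrite /hat_ract hat_meetE => -[Aσ /jQE σz] σx bY xy.
    apply: (h σ x y Aσ σx _ xy); rewrite /Q_lact opens_meetE; split=> //.
    have [t zt tx] := σz _ σx; apply: (saturated _ zt).
    by rewrite -xy -tx gcod_inv.
Qed.

End separation.

Hypothesis arr_locally_compact : forall x (A : set (arr G)), open A -> A x ->
  exists K : set (arr G), [/\ compact K, nbhs x K & K `<=` A].
Hypothesis enough_bisections :
  forall x : arr G, exists2 S, bisection_set S & S x.

Lemma j_tensor_id_reflects (X Y : tensor (@Q_ract Q) (@Q_lact Q)) :
  j_tensor_id X ⊑ j_tensor_id Y -> X ⊑ Y.
Proof.
move=> XY [a b] Xab; pose Z : tensor (@hat_ract Q) (@Q_lact Q) :=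
  exist _ _ (covered_closed Y).
have YZ : j_tensor_id Y ⊑ Z.
  apply: ssup_le => _ [[a' b'] Yab <-]; apply/pure_le => σ x y /jQE σa σx bY _.
  by exists a', b'; split=> //; exact: σa.
have : sval Z (jQ a, b).
  apply/pure_le; apply: sle_trans YZ; apply: sle_trans XY.
  by apply: ssup_ub; exists (a, b).
move=> Zab; apply: tensor_spatial => // x y ax bY xy.
have [S hS Sx] := enough_bisections x.
pose σ := set_bisection hS.
have σx : graph σ x by rewrite graph_set_bisection.
apply: (Zab (restr (bim_le σ a)) x y) => //.
- apply/jQE; rewrite graph_restr => t [σt /bimE[t' [σt' at' tt']]].
  by rewrite -(graph_dom_inj σt' σt tt').
- by rewrite graph_restr; split=> //; exact: σx.
Qed.

Lemma groupoid_embeddable : embeddable Q.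
Proof.
split; first exact: groupoid_weakly_embeddable.
move=> N g h gh n; have e := gh n; rewrite /= in e.
by apply: sle_anti; apply: j_tensor_id_reflects; rewrite e; exact: sle_refl.
Qed.

End bisection_sets.

(** * Lie groupoids are coverable *)

Theorem corollary5p32 (R : realType) (n m : nat) (G : lieGroupoid R n m) :
  coverable G.
Proof.
have through := lie_bisection_through (G := G).
have G_open : open_groupoid G.
  move=> A oA; rewrite openE => _ [x Ax <-].
  have [S [_ _ opS _] Sx] := through x.
  apply: filterS (open_nbhs_nbhs (conj (opS A oA) _)); last by exists x.
  by move=> _ [y [_ Ay] <-]; exists y.
exists G_open; apply: groupoid_embeddable => //.
- exact: obj_hausdorff.
- exact: arr_hausdorff.
- move=> x A oA Ax; have [c _ cx] := (arr_atlasP G).1 x.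
  exact: chart_locally_compact (@rV_compact_balls R m) cx oA Ax.
Qed.
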